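(* Consider the DORE algorithm with $R=0$ (defined in the context), with parameters $\alpha,\beta,\gamma,\eta$, for minimizing $f=\frac1n\sum_{i=1}^n f_i$ over $\mathbb{R}^d$, where $f$ may be nonconvex. Assume that the worker and master compression operators satisfy the compression assumption with nonnegative constants $C_q$ and $C_q^m$ respectively; that the stochastic gradients satisfy the sampling assumption; that each $f_i$ is $L$-Lipschitz differentiable, i.e. $f_i(\mathbf{x})\le f_i(\mathbf{y})+\langle\nabla f_i(\mathbf{y}),\mathbf{x}-\mathbf{y}\rangle+\frac L2\|\mathbf{x}-\mathbf{y}\|^2$ for all $\mathbf{x},\mathbf{y}\in\mathbb{R}^d$; and, additionally, that each worker samples the gradient from the full dataset (so that $\mathbf{g}_i^k$ is an unbiased estimator of $\nabla f(\hat{\mathbf{x}}^k)$ for every $i$). Let $\alpha$ and $\beta$ satisfy $$\frac{1-\sqrt{1-\frac{4C_q(C_q+1)}{nc}}}{2(C_q+1)}\le\alpha\le\frac{1+\sqrt{1-\frac{4C_q(C_q+1)}{nc}}}{2(C_q+1)},\qquad 0<\beta\le\frac{1}{C_q^m+1},$$ with $c\ge\frac{4C_q(C_q+1)}{n}$. By choosing $$\gamma\le\min\left\{\frac{-1+\sqrt{1+\frac{48L^2\beta^2(C_q^m+1)^2}{C_q^m}}}{12L\beta(C_q^m+1)},\ \frac{1}{6L\beta(1+c\alpha)(C_q^m+1)}\right\},$$ we have $$\frac{\frac\beta2-3(1+c\alpha)(C_q^m+1)L\beta^2\gamma}{K}\sum_{k=1}^K\mathbb{E}\|\nabla f(\hat{\mathbf{x}}^k)\|^2\le\frac{\mathbb{E}\Lambda^1-\mathbb{E}\Lambda^{K+1}}{\gamma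 K}+\frac{3(C_q^m+1)(1+nc\alpha)L\beta^2\sigma^2\gamma}{n},$$ where $$\Lambda^k=(C_q^m+1)L\beta^2\|\mathbf{q}^{k-1}\|^2+f(\hat{\mathbf{x}}^k)-f^*+3c(C_q^m+1)L\beta^2\gamma^2\,\frac1n\sum_{i=1}^n\mathbb{E}\|\mathbf{h}_i^k\|^2$$ and $f^*$ is the optimal value of $f$.
   Context: Setting: $n$ workers and one master; $f_i:\mathbb{R}^d\to\mathbb{R}$ is the local objective of worker $i$. $\|\cdot\|$ is the Euclidean norm and $\mathbb{E}$ is the overall expectation. Compression assumption with constant $C\ge0$: the stochastic operator $Q:\mathbb{R}^d\to\mathbb{R}^d$ is unbiased, $\mathbb{E}\,Q(\mathbf{x})=\mathbf{x}$, and satisfies $\mathbb{E}\|Q(\mathbf{x})-\mathbf{x}\|^2\le C\|\mathbf{x}\|^2$, with $C$ independent of $\mathbf{x}$. All workers use the same compression operator, with constant $C_q$; the master may use a different one, with constant $C_q^m$. Sampling assumption: each worker samples an unbiased estimator of its gradient with bounded variance, i.e. for $i=1,\dots,n$ and all $\mathbf{x}\in\mathbb{R}^d$, the estimator $\mathbf{g}_i$ of $\nabla f_i$ at $\mathbf{x}$ satisfies $\mathbb{E}[\mathbf{g}_i|\mathbf{x}]=\nabla f_i(\mathbf{x})$ and $\mathbb{E}\|\mathbf{g}_i-\nabla f_i(\mathbf{x})\|^2\le\sigma_i^2$. Moreover $\sigma^2=\frac1n\sum_{i=1}^n\sigma_i^2$. DORE algorithm with $R=0$ (parameters $\alpha,\beta,\gamma,\eta$):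 initialize $\mathbf{h}^0=\mathbf{h}_i^0=\mathbf{0}$ and the same $\hat{\mathbf{x}}_i^0=\hat{\mathbf{x}}^0$ for all $i$. Iteration $k$ performs the following. Workers: each worker $i$ samples $\mathbf{g}_i^k$ with $\mathbb{E}[\mathbf{g}_i^k|\hat{\mathbf{x}}_i^k]=\nabla f_i(\hat{\mathbf{x}}_i^k)$, sets $\Delta_i^k=\mathbf{g}_i^k-\mathbf{h}_i^k$, compresses $\hat\Delta_i^k=Q(\Delta_i^k)$, sets $\mathbf{h}_i^{k+1}=\mathbf{h}_i^k+\alpha\hat\Delta_i^k$, and sends $\hat\Delta_i^k$ to the master. Master: $\hat\Delta^k=\frac1n\sum_i\hat\Delta_i^k$, $\hat{\mathbf{g}}^k=\mathbf{h}^k+\hat\Delta^k$, $\mathbf{h}^{k+1}=\mathbf{h}^k+\alpha\hat\Delta^k$, $\mathbf{q}^k=-\gamma\hat{\mathbf{g}}^k+\eta\mathbf{e}^k$, $\hat{\mathbf{q}}^k=Q(\mathbf{q}^k)$, $\mathbf{e}^{k+1}=\mathbf{q}^k-\hat{\mathbf{q}}^k$ (the error being compensated); it broadcasts $\hat{\mathbf{q}}^k$. Each worker then sets $\hat{\mathbf{x}}_i^{k+1}=\hat{\mathbf{x}}_i^k+\beta\hat{\mathbf{q}}^k$; all $\hat{\mathbf{x}}_i^k$ coincide and are denoted $\hat{\mathbf{x}}^k$.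
   Formalization: The formal theorem adds |η| ≤ γ (the claim fails for large η) and takes γ > 0, L > 0 and f bounded below; when C_q^m = 0 the first bound on γ, undefined there, is read as +∞. *)

(* Defs.v *)
From HB Require Import structures.
From mathcomp Require Import all_boot all_order all_algebra.
From mathcomp Require Import all_classical all_reals all_analysis.

Set Implicit Arguments.
Unset Strict Implicit.
Unset Printing Implicit Defensive.

Import Order.TTheory GRing.Theory Num.Theory.
Import numFieldNormedType.Exports.

Local Open Scope classical_set_scope.
Local Open Scope ring_scope.

(* Vectors of R^d are row vectors.  The norm `|x| of the library on 'rV[R]_d is
   the sup norm, hence the Euclidean structure is spelled out here. *)
Definition dotv (R : realType) (d : nat) (u v : 'rV[R]_d) : R :=
  \sum_j u 0 j * v 0 j.

Definition sqnorm (R : realType) (d : nat) (u : 'rV[R]_d) : R := dotv u u.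

Definition grad (R : realType) (d : nat) (f : 'rV[R]_d -> R) (x : 'rV[R]_d) :
  'rV[R]_d := \row_j 'D_(delta_mx 0 j) f x.

Definition lipschitz_differentiable (R : realType) (d : nat) (L : R)
    (f : 'rV[R]_d -> R) : Prop :=
  (forall x, differentiable f x) /\
  (forall x y,
     f x <= f y + dotv (grad f y) (x - y) + L / 2 * sqnorm (x - y)).

Definition average (R : realType) (d n : nat) (fi : 'I_n -> 'rV[R]_d -> R)
  (x : 'rV[R]_d) : R := n%:R^-1 * \sum_i fi i x.

Definition optimal_value (R : realType) (d : nat) (f : 'rV[R]_d -> R) : R :=
  inf (range f).

(* A stochastic operator on R^d: a map depending on a random seed.  Measurability
   is joint, for the Borel sigma-algebra on R^d presented as the product
   sigma-algebra on d-tuples. *)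
Record random_map (R : realType) (d : nat) := RandomMap {
  seed_display : measure_display;
  seed : measurableType seed_display;
  seed_law : probability seed R;
  realize : seed -> 'rV[R]_d -> 'rV[R]_d;
  measurable_realize : forall j,
    measurable_fun [set: seed * d.-tuple R]
      (fun p => realize p.1 (\row_i tnth p.2 i) 0 j) }.

Arguments realize {R d} r.

Definition unbiased_for (R : realType) (d : nat) (Q : random_map R d)
    (F : 'rV[R]_d -> 'rV[R]_d) : Prop :=
  forall x j,
    (seed_law Q).-integrable setT (fun z => (realize Q z x 0 j)%:E) /\
    'E_(seed_law Q)[fun z => realize Q z x ord0 j]%E = (F x 0 j)%:E.

Definition compression_operator (R : realType) (d : nat) (C : R)
    (Q : random_map R d) : Prop :=
  unbiased_for Q id /\
  (forall x, 'E_(seed_law Q)[fun z => sqnorm (realize Q z x - x)%R]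
               <= (C * sqnorm x)%:E)%E.

Definition gradient_sampler (R : realType) (d : nat) (s : R)
    (f : 'rV[R]_d -> R) (G : random_map R d) : Prop :=
  unbiased_for G (grad f) /\
  (forall x, 'E_(seed_law G)[fun z => sqnorm (realize G z x - grad f x)%R]
               <= (s ^+ 2)%:E)%E.

Definition mutually_independent (dsp : measure_display)
    (Omega : measurableType dsp) (R : realType) (P : probability Omega R)
    (I : eqType) (E : I -> set (set Omega)) : Prop :=
  forall (J : seq I) (A : I -> set Omega),
    uniq J -> (forall i, i \in J -> E i (A i)) ->
    (P (\bigcap_(i in [set` J]) A i) = \prod_(i <- J) P (A i))%E.

(* All the randomness of a run: at every iteration each worker draws a fresh seed
   for its gradient (xi) and one for its compression (zeta), and the master draws
   one for its own compression (omega). *)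
Definition seed_events (dsp : measure_display) (Omega : measurableType dsp)
    (R : realType) (P : probability Omega R) (d n : nat)
    (G : 'I_n -> random_map R d) (Qw Qm : random_map R d)
    (xi : forall i, nat -> {RV P >-> seed (G i)})
    (zeta : 'I_n -> nat -> {RV P >-> seed Qw})
    (omega : nat -> {RV P >-> seed Qm})
    (s : ('I_n * nat + 'I_n * nat + nat)%type) : set (set Omega) :=
  match s with
  | inl (inl (i, k)) => preimage_set_system setT (xi i k) measurable
  | inl (inr (i, k)) => preimage_set_system setT (zeta i k) measurable
  | inr k => preimage_set_system setT (omega k) measurable
  end.

Definition fresh_seeds (dsp : measure_display) (Omega : measurableType dsp)
    (R : realType) (P : probability Omega R) (d n : nat)
    (G : 'I_n -> random_map R d) (Qw Qm : random_map R d)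
    (xi : forall i, nat -> {RV P >-> seed (G i)})
    (zeta : 'I_n -> nat -> {RV P >-> seed Qw})
    (omega : nat -> {RV P >-> seed Qm}) : Prop :=
  [/\ forall i k A, measurable A -> distribution P (xi i k) A = seed_law (G i) A,
      forall i k A, measurable A -> distribution P (zeta i k) A = seed_law Qw A,
      forall k A, measurable A -> distribution P (omega k) A = seed_law Qm A &
      mutually_independent P (seed_events xi zeta omega)].

(* The local models of all workers start equal and receive the same updates, so
   only their common value [model] is kept. *)
Record dore_state (R : realType) (d n : nat) := DoreState {
  model : 'rV[R]_d;
  worker_h : 'I_n -> 'rV[R]_d;
  master_h : 'rV[R]_d;
  error : 'rV[R]_d }.

Definition dore_dhat (R : realType) (d n : nat)
    (g Q : 'I_n -> 'rV[R]_d -> 'rV[R]_d) (s : dore_state R d n) (i : 'I_n) :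
  'rV[R]_d := Q i (g i (model s) - worker_h s i).

Definition dore_mean_dhat (R : realType) (d n : nat)
    (g Q : 'I_n -> 'rV[R]_d -> 'rV[R]_d) (s : dore_state R d n) : 'rV[R]_d :=
  n%:R^-1 *: \sum_i dore_dhat g Q s i.

Definition dore_query (R : realType) (d n : nat) (gamma eta : R)
    (g Q : 'I_n -> 'rV[R]_d -> 'rV[R]_d) (s : dore_state R d n) : 'rV[R]_d :=
  - gamma *: (master_h s + dore_mean_dhat g Q s) + eta *: error s.

(* [g], [Q] and [Qm] are the maps realized at the current iteration. *)
Definition dore_step (R : realType) (d n : nat) (alpha beta gamma eta : R)
    (g Q : 'I_n -> 'rV[R]_d -> 'rV[R]_d) (Qm : 'rV[R]_d -> 'rV[R]_d)
    (s : dore_state R d n) : dore_state R d n :=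
  let q := dore_query gamma eta g Q s in
  let qhat := Qm q in
  {| model := model s + beta *: qhat;
     worker_h := fun i => worker_h s i + alpha *: dore_dhat g Q s i;
     master_h := master_h s + alpha *: dore_mean_dhat g Q s;
     error := q - qhat |}.

Fixpoint dore_run (R : realType) (d n : nat) (alpha beta gamma eta : R)
    (x0 e0 : 'rV[R]_d) (g Q : nat -> 'I_n -> 'rV[R]_d -> 'rV[R]_d)
    (Qm : nat -> 'rV[R]_d -> 'rV[R]_d) (k : nat) : dore_state R d n :=
  match k with
  | 0%N => {| model := x0; worker_h := fun=> 0; master_h := 0; error := e0 |}
  | k'.+1 => dore_step alpha beta gamma eta (g k') (Q k') (Qm k')
               (dore_run alpha beta gamma eta x0 e0 g Q Qm k')
  end.

Record dore_process (Omega : Type) (R : realType) (d n : nat) := DoreProcess {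
  xhat : nat -> Omega -> 'rV[R]_d;
  hloc : 'I_n -> nat -> Omega -> 'rV[R]_d;
  qvec : nat -> Omega -> 'rV[R]_d }.

Definition dore (dsp : measure_display) (Omega : measurableType dsp)
    (R : realType) (P : probability Omega R) (d n : nat)
    (alpha beta gamma eta : R) (x0 e0 : 'rV[R]_d)
    (G : 'I_n -> random_map R d) (Qw Qm : random_map R d)
    (xi : forall i, nat -> {RV P >-> seed (G i)})
    (zeta : 'I_n -> nat -> {RV P >-> seed Qw})
    (omega : nat -> {RV P >-> seed Qm}) : dore_process Omega R d n :=
  let g w k i := realize (G i) (xi i k w) in
  let Q w k i := realize Qw (zeta i k w) in
  let S w := dore_run alpha beta gamma eta x0 e0 (g w) (Q w)
               (fun k => realize Qm (omega k w)) in
  {| xhat := fun k w => model (S w k);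
     hloc := fun i k w => worker_h (S w k) i;
     qvec := fun k w => dore_query gamma eta (g w k) (Q w k) (S w k) |}.

(* Used for k >= 1 only.  It is extended-real-valued because of the expectations
   inside. *)
Definition Lyapunov (dsp : measure_display) (Omega : measurableType dsp)
    (R : realType) (P : probability Omega R) (d n : nat)
    (f : 'rV[R]_d -> R) (L Cm c beta gamma : R) (X : dore_process Omega R d n)
    (k : nat) (w : Omega) : \bar R :=
  (((Cm + 1) * L * beta ^+ 2 * sqnorm (qvec X k.-1 w)
     + f (xhat X k w) - optimal_value f)%:E
   + (3 * c * (Cm + 1) * L * beta ^+ 2 * gamma ^+ 2)%:E
     * ((n%:R^-1)%:E * \sum_(i < n) 'E_P[fun w' => sqnorm (hloc X i k w')]))%E.

(* For Cm = 0 the first bound has a zero denominator and is read as +oo, its limit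
   when Cm tends to 0. *)
Definition gamma_max (R : realType) (L Cm c alpha beta : R) : R :=
  let b1 := (-1 + Num.sqrt (1 + 48 * L ^+ 2 * beta ^+ 2 * (Cm + 1) ^+ 2 / Cm))
              / (12 * L * beta * (Cm + 1)) in
  let b2 := 1 / (6 * L * beta * (1 + c * alpha) * (Cm + 1)) in
  if Cm == 0 then b2 else Num.min b1 b2.

(* Main.v *)
(* Put M = (Cm+1) L beta^2.  Conditionally on the past, the descent inequality and
   the two moment bounds on the master compression give
     E f(x^(k+1)) <= E f(x^k) + beta E<grad f(x^k), q^k> + M/2 E|q^k|^2.
   The noises r_i of the n workers are centered and mutually orthogonal, so
   E|q^k|^2 = E|eta e^k - gamma grad f|^2 + gamma^2/n^2 sum_i E|r_i|^2, with
   E|r_i|^2 <= Cq E|grad f - h_i|^2 + (Cq+1) sigma_i^2; here grad f_i = grad f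
   because both are means of the same estimator.  Expanding E|h_i^(k+1)|^2 in the
   same way produces the term (alpha^2 (Cq+1) - alpha) E|grad f - h_i|^2, whose
   coefficient is at most - Cq/(n c) by the choice of alpha, which absorbs the
   compression noise; the bound on gamma absorbs the error e^k, for which
   E|e^k|^2 <= Cm E|q^(k-1)|^2.  The Lyapunov function then decreases up to the
   variance term and the sum telescopes.  All expectations are finite because
   |grad f|^2 <= 2 L (f - f^* ) and f has a quadratic upper bound. *)
Require Import Defs.
From HB Require Import structures.
From mathcomp Require Import all_boot all_order all_algebra.
From mathcomp Require Import all_classical all_reals all_analysis.
From mathcomp Require Import measurable_realfun ring lra.

Set Implicit Arguments.
Unset Strict Implicit.
Unset Printing Implicit Defensive.

Import Order.TTheory GRing.Theory Num.Theory.
Import numFieldNormedType.Exports.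

Local Open Scope classical_set_scope.
Local Open Scope ring_scope.

(** * Integrating out a fresh seed *)

Section sub_sigma_algebra.
Context (dsp : measure_display) (Omega : measurableType dsp).
Context (G : set (set Omega)) (G_meas : G `<=` measurable).

Lemma sub_sigma_measurable (A : set Omega) : <<s G >> A -> measurable A.
Proof.
by apply: smallest_sub => //; exact: sigma_algebra_measurable.
Qed.

Lemma measurable_fun_sub_sigma d (T : measurableType d)
    (f : g_sigma_algebraType G -> T) :
  measurable_fun setT f -> measurable_fun (setT : set Omega) f.
Proof.
by move=> mf _ B mB; apply: sub_sigma_measurable; exact: mf.
Qed.

Let OG : measurableType (sigma_display G) := g_sigma_algebraType G.

(* The past enters as [Omega] itself with the sub-sigma-algebra [<<s G>>]: the law of
   the pair (identity, Z) is then a product measure and Tonelli applies. *)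
Lemma ge0_freezing (R : realType) (P : probability Omega R)
    d (S : measurableType d) (nu : probability S R) (Z : {RV P >-> S})
    (phi : OG * S -> \bar R) :
  (forall A B, <<s G >> A -> measurable B ->
     P (A `&` Z @^-1` B) = (P A * nu B)%E) ->
  measurable_fun setT phi -> (forall p, 0 <= phi p)%E ->
  (\int[P]_w phi (w, Z w) = \int[P]_w \int[nu]_z phi (w, z))%E.
Proof.
move=> indep mphi phi0.
have mid : measurable_fun (setT : set Omega) (id : Omega -> OG).
  by move=> _ A mA; rewrite setTI; exact: sub_sigma_measurable.
pose idG : Omega -> OG := id.
pose m1 := isMeasurableFun.Build _ _ _ _ idG mid.
pose Y : {RV P >-> OG} := HB.pack idG m1.
have mpair : measurable_fun (setT : set Omega)
    ((fun w => (w, Z w)) : Omega -> OG * S).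
  by apply: measurable_fun_pair.
pose pairG : Omega -> OG * S := fun w => (w, Z w).
pose m2 := isMeasurableFun.Build _ _ _ _ pairG mpair.
pose W : {RV P >-> (OG * S)%type} := HB.pack pairG m2.
transitivity (\int[distribution P W]_p phi p)%E.
  by rewrite ge0_integral_distribution.
transitivity (\int[distribution P Y \x nu]_p phi p)%E.
  apply: eq_measure_integral => A mA _; apply/esym.
  apply: product_measure_unique => //.
rewrite fubini_tonelli1// ge0_integral_distribution//.
  exact: measurable_fun_fubini_tonelli_F.
by move=> w; exact: integral_ge0.
Qed.

(** The nonnegative case applies to the positive and negative parts: for every frozen [w] the zero
    mean makes their inner integrals agree, and integrability under [P] allows the outer ones to be
    subtracted. *)
Lemma freezing_centered (R : realType) (P : probability Omega R)
    d (S : measurableType d) (nu : probability S R) (Z : {RV P >-> S})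
    (phi : OG * S -> \bar R) :
  (forall A B, <<s G >> A -> measurable B ->
     P (A `&` Z @^-1` B) = (P A * nu B)%E) ->
  measurable_fun setT phi ->
  P.-integrable setT (fun w => phi (w, Z w)) ->
  (forall w, nu.-integrable setT (fun z => phi (w, z))) ->
  (forall w, \int[nu]_z phi (w, z) = 0)%E ->
  (\int[P]_w phi (w, Z w) = 0)%E.
Proof.
move=> indep mphi iphi jphi phi0; rewrite integralE.
have sub_eq0 (a b : \bar R) : a \is a fin_num -> b \is a fin_num ->
    (a - b = 0)%E -> a = b.
  by move: a b => [a||] [b||]// _ _ [] /eqP; rewrite subr_eq0 => /eqP ->.
have posneg w : (\int[nu]_z (phi^\+)%E (w, z) = \int[nu]_z (phi^\-)%E (w, z))%E.
  have := phi0 w; rewrite integralE.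
  have fp := integrable_pos_fin_num measurableT (jphi w).
  have fn := integrable_neg_fin_num measurableT (jphi w).
  by rewrite !unlock in fp fn * => /(sub_eq0 _ _ fp fn).
suff -> : (\int[P]_w ((fun w => phi (w, Z w))^\+)%E w =
           \int[P]_w ((fun w => phi (w, Z w))^\-)%E w)%E.
  by rewrite subee//; exact: integrable_neg_fin_num.
rewrite (funepos_comp phi (fun w => (w, Z w))).
rewrite (funeneg_comp phi (fun w => (w, Z w))) /=.
rewrite (ge0_freezing (phi:=(phi^\+)%E) indep)//; last first.
  exact: measurable_funepos.
rewrite (ge0_freezing (phi:=(phi^\-)%E) indep)//; last first.
  exact: measurable_funeneg.
exact: eq_integral.
Qed.

End sub_sigma_algebra.

(** * Square-integrable random vectors *)

Section dot_product.
Context (R : realType) (d : nat).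
Implicit Types (u v w : 'rV[R]_d) (a : R).

Lemma dotvC u v : dotv u v = dotv v u.
Proof. by apply: eq_bigr => j _; rewrite mulrC. Qed.

Lemma dotvDl u v w : dotv (u + v) w = dotv u w + dotv v w.
Proof. by rewrite -big_split; apply: eq_bigr => j _; rewrite mxE mulrDl. Qed.

Lemma dotvZl a u v : dotv (a *: u) v = a * dotv u v.
Proof. by rewrite mulr_sumr; apply: eq_bigr => j _; rewrite mxE mulrA. Qed.

Lemma sqnorm_ge0 u : 0 <= sqnorm u.
Proof. by apply: sumr_ge0 => j _; rewrite -expr2 sqr_ge0. Qed.

End dot_product.

Section square_integrable.
Context (R : realType) (dsp : measure_display) (Omega : measurableType dsp).
Context (P : probability Omega R) (d : nat).
Implicit Types (X Y Z : Omega -> 'rV[R]_d) (a : R) (G : set (set Omega)).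

(** [G] is a generating family: measurability refers to [<<s G>>], which will be the information
    carried by a set of seeds. *)
Definition adapted G X := forall j,
  measurable_fun (setT : set (g_sigma_algebraType G)) (fun w => X w 0 j).

Lemma adapted_sub G G' X : G `<=` <<s G' >> -> adapted G X -> adapted G' X.
Proof.
move=> GG' aX j _ B mB; suff : <<s G >> `<=` <<s G' >>.
  by apply; exact: aX.
by apply: smallest_sub => //; exact: smallest_sigma_algebra.
Qed.

Lemma adapted_cst G (x : 'rV[R]_d) : adapted G (fun=> x).
Proof. by move=> j; exact: measurable_cst. Qed.

Lemma adaptedD G X Y : adapted G X -> adapted G Y -> adapted G (X + Y).
Proof.
move=> aX aY j; rewrite (_ : (fun _ => _) =
    (fun w => X w 0 j) \+ (fun w => Y w 0 j)); first exact: measurable_funD.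
by apply/funext => w; rewrite /= mxE.
Qed.

Lemma adaptedZ G a X : adapted G X -> adapted G (a *: X).
Proof.
move=> aX j; rewrite (_ : (fun _ => _) = cst a \* (fun w => X w 0 j)).
  exact: measurable_funM.
by apply/funext => w; rewrite /= mxE.
Qed.

Lemma adaptedB G X Y : adapted G X -> adapted G Y -> adapted G (X - Y).
Proof.
by move=> aX aY; rewrite -scaleN1r; apply: adaptedD => //; exact: adaptedZ.
Qed.

Lemma adapted_sum G (I : Type) (s : seq I) (X : I -> Omega -> 'rV[R]_d) :
  (forall i, adapted G (X i)) -> adapted G (\sum_(i <- s) X i).
Proof.
move=> aX; elim: s => [|i s IHs]; last by rewrite big_cons; exact: adaptedD.
by rewrite big_nil; exact: adapted_cst.
Qed.

Definition square_integrable X := forall j,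
  measurable_fun setT (fun w => X w 0 j) /\
  P.-integrable setT (fun w => (X w 0 j ^+ 2)%:E).

Lemma integrable_coord_mul X Y j :
  square_integrable X -> square_integrable Y ->
  P.-integrable setT (fun w => (X w 0 j * Y w 0 j)%:E).
Proof.
move=> /(_ j)[mX iX] /(_ j)[mY iY].
apply: (@le_integrable _ _ _ P setT measurableT _
  (fun w => (X w 0 j ^+ 2)%:E + (Y w 0 j ^+ 2)%:E)%E).
- by apply/measurable_EFinP; exact: measurable_funM.
- move=> w _; rewrite -EFinD !abse_EFin lee_fin.
  rewrite [leRHS]ger0_norm ?addr_ge0 ?sqr_ge0// ler_norml.
  have := sqr_ge0 (X w 0 j + Y w 0 j); have := sqr_ge0 (X w 0 j - Y w 0 j).
  have := sqr_ge0 (X w 0 j); have := sqr_ge0 (Y w 0 j).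
  by move=> *; apply/andP; split; lra.
- exact: integrableD.
Qed.

Lemma integrable_dotv X Y : square_integrable X -> square_integrable Y ->
  P.-integrable setT (fun w => (dotv (X w) (Y w))%:E).
Proof.
move=> sX sY; under eq_fun do rewrite -sumEFin.
by apply: integrable_sum => // j _; exact: integrable_coord_mul.
Qed.

(** Each squared coordinate is at most [sqnorm]. This turns a moment bound between extended reals
    into the finiteness behind the real-valued [ip]. *)
Lemma square_integrableP X :
  (forall j, measurable_fun setT (fun w => X w 0 j)) ->
  ('E_P[fun w => sqnorm (X w)] < +oo)%E -> square_integrable X.
Proof.
move=> mX; rewrite unlock => fX j; split; first exact: mX.
apply/integrableP; split.
  by apply/measurable_EFinP; exact: measurable_funX.
apply: le_lt_trans fX; apply: ge0_le_integral => //.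
- apply: measurableT_comp => //; apply/measurable_EFinP; exact: measurable_funX.
- apply/measurable_EFinP; apply: measurable_sum => i; exact: measurable_funM.
- move=> w _; rewrite abse_EFin lee_fin ger0_norm ?sqr_ge0//.
  rewrite /sqnorm /dotv (bigD1 j)//= expr2 lerDl sumr_ge0// => i _.
  by rewrite -expr2 sqr_ge0.
Qed.

Lemma square_integrable_cst (x : 'rV[R]_d) : square_integrable (fun=> x).
Proof.
move=> j; split; first exact: measurable_cst.
exact: finite_measure_integrable_cst.
Qed.

Lemma square_integrableZ a X :
  square_integrable X -> square_integrable (a *: X).
Proof.
move=> sX j; have [mX iX] := sX j; split.
  rewrite (_ : (fun _ => _) = cst a \* (fun w => X w 0 j)).
    exact: measurable_funM.
  by apply/funext => w; rewrite /= mxE.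
rewrite (_ : (fun _ => _) = fun w => (a ^+ 2)%:E * (X w 0 j ^+ 2)%:E)%E.
  exact: integrableZl.
by apply/funext => w; rewrite /= mxE exprMn.
Qed.

Lemma square_integrableD X Y : square_integrable X -> square_integrable Y ->
  square_integrable (X + Y).
Proof.
move=> sX sY j; have [[mX iX] [mY iY]] := (sX j, sY j); split.
  rewrite (_ : (fun _ => _) = (fun w => X w 0 j) \+ (fun w => Y w 0 j)).
    exact: measurable_funD.
  by apply/funext => w; rewrite /= mxE.
have iXY := integrable_coord_mul j sX sY.
rewrite (_ : (fun _ => _) = ((fun w => (X w 0 j ^+ 2)%:E) \+
   ((fun w => 2%:E * (X w 0 j * Y w 0 j)%:E) \+
    (fun w => (Y w 0 j ^+ 2)%:E)))%E).
  by do 2 apply: integrableD => //; exact: integrableZl.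
by apply/funext => w; rewrite /= mxE -EFinM -!EFinD; congr EFin; ring.
Qed.

Lemma square_integrableB X Y : square_integrable X -> square_integrable Y ->
  square_integrable (X - Y).
Proof.
move=> sX sY; rewrite -scaleN1r; apply: square_integrableD => //.
exact: square_integrableZ.
Qed.

Lemma square_integrable_sum (I : Type) (s : seq I)
    (X : I -> Omega -> 'rV[R]_d) :
  (forall i, square_integrable (X i)) ->
  square_integrable (\sum_(i <- s) X i).
Proof.
move=> sX; elim: s => [|i s IHs].
  by rewrite big_nil; exact: square_integrable_cst.
by rewrite big_cons; exact: square_integrableD.
Qed.

(** The inner product of L^2 as a real number. [Rintegral] sends an infinite integral to [0], so
    linearity is stated under square integrability. *)
Definition ip X Y : R := Rintegral P setT (fun w => dotv (X w) (Y w)).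

Lemma ipE X Y : square_integrable X -> square_integrable Y ->
  (\int[P]_w (dotv (X w) (Y w))%:E = (ip X Y)%:E)%E.
Proof.
move=> sX sY; rewrite /ip /Rintegral fineK//.
by apply: integrable_fin_num => //; exact: integrable_dotv.
Qed.

Lemma expectation_sqnorm X : square_integrable X ->
  'E_P[fun w => sqnorm (X w)]%E = (ip X X)%:E.
Proof. by move=> sX; rewrite unlock -ipE. Qed.

Lemma ipC X Y : ip X Y = ip Y X.
Proof. by apply: eq_Rintegral => w _; rewrite dotvC. Qed.

Lemma ip_ge0 X : 0 <= ip X X.
Proof. by apply: Rintegral_ge0 => w _; exact: sqnorm_ge0. Qed.

Lemma ipDl X Y Z : square_integrable X -> square_integrable Y ->
  square_integrable Z -> ip (X + Y) Z = ip X Z + ip Y Z.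
Proof.
move=> sX sY sZ; rewrite /ip -RintegralD//; [|exact: integrable_dotv..].
by apply: eq_Rintegral => w _; rewrite -dotvDl.
Qed.

Lemma ipZl a X Z : square_integrable X -> square_integrable Z ->
  ip (a *: X) Z = a * ip X Z.
Proof.
move=> sX sZ; rewrite /ip -RintegralZl//; last exact: integrable_dotv.
by apply: eq_Rintegral => w _; rewrite -dotvZl.
Qed.

Lemma ip_suml (I : Type) (s : seq I) (X : I -> Omega -> 'rV[R]_d) Z :
  (forall i, square_integrable (X i)) -> square_integrable Z ->
  ip (\sum_(i <- s) X i) Z = \sum_(i <- s) ip (X i) Z.
Proof.
move=> sX sZ; elim: s => [|i s IHs]; last first.
  by rewrite !big_cons -IHs ipDl//; exact: square_integrable_sum.
rewrite !big_nil (_ : 0 = 0 *: Z :> (Omega -> _)) ?ipZl ?mul0r//.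
by rewrite scale0r.
Qed.

(** With [a = 1] and a vanishing cross term this is the Pythagorean identity, the form in which
    variances are decomposed below. *)
Lemma ip_sqrD a X Y : square_integrable X -> square_integrable Y ->
  ip (X + a *: Y) (X + a *: Y) = ip X X + 2 * a * ip X Y + a ^+ 2 * ip Y Y.
Proof.
move=> sX sY; have saY := square_integrableZ a sY.
have sXY := square_integrableD sX saY.
rewrite ipDl// ipZl// [ip X _]ipC [ip Y _]ipC !ipDl// !ipZl// [ip Y X]ipC.
ring.
Qed.

End square_integrable.

(** * Mean and variance of a random map evaluated with a fresh seed *)

Section fresh_random_map.
Context (R : realType) (dsp : measure_display) (Omega : measurableType dsp).
Context (P : probability Omega R) (d : nat) (Q : random_map R d).
Context (Z : {RV P >-> seed Q}) (G : set (set Omega)).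
Hypothesis G_meas : G `<=` measurable.
Hypothesis Z_fresh : forall A B, <<s G >> A -> measurable B ->
  (P (A `&` Z @^-1` B) = P A * seed_law Q B)%E.
Context (v : Omega -> 'rV[R]_d) (v_adapted : adapted G v).
Let Y w := realize Q (Z w) (v w).

(** Joint measurability of [Q] is expressed on tuples, so the random point is first packed into the
    tuple of its coordinates. *)
Lemma measurable_realize_comp d' (T : measurableType d') (z : T -> seed Q)
    (x : T -> 'rV[R]_d) j :
  measurable_fun setT z -> (forall i, measurable_fun setT (fun t => x t 0 i)) ->
  measurable_fun setT (fun t => realize Q (z t) (x t) 0 j).
Proof.
move=> mz mx.
rewrite (_ : (fun _ => _) = (fun p => realize Q p.1 (\row_i tnth p.2 i) 0 j) \o
    (fun t => (z t, [tuple x t 0 i | i < d]))).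
  apply: measurableT_comp; first exact: measurable_realize.
  apply: measurable_fun_pair => //; apply/measurable_fun_tnthP => i.
  by rewrite (_ : _ \o _ = fun t => x t 0 i)//; apply/funext => t /=;
     rewrite tnth_mktuple.
apply/funext => t /=; congr (realize Q _ _ 0 j).
by apply/rowP => i; rewrite mxE tnth_mktuple.
Qed.

Lemma adapted_realize G' : G `<=` <<s G' >> ->
  (forall B, measurable B -> <<s G' >> (Z @^-1` B)) -> adapted G' Y.
Proof.
move=> GG' ZG' j; apply: measurable_realize_comp => [_ B mB|].
  by rewrite setTI; exact: ZG'.
exact: adapted_sub v_adapted.
Qed.

Context (F : 'rV[R]_d -> 'rV[R]_d) (Q_unbiased : unbiased_for Q F).
Let OG : measurableType (sigma_display G) := g_sigma_algebraType G.

(* No regularity of [F] is needed: it is a partial integral of the jointly measurable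
   map [realize Q]. *)
Lemma adapted_mean : adapted G (F \o v).
Proof.
move=> j; pose r (p : OG * seed Q) := (realize Q p.2 (v p.1) 0 j)%:E.
have mr : measurable_fun setT r.
  apply/measurable_EFinP; apply: measurable_realize_comp => // i.
  by apply: (measurableT_comp (f := fun w : OG => v w 0 i)).
(* Tonelli gives measurability in the parameter for nonnegative integrands, so the mean is split
   into the integrals of the two parts. *)
rewrite (_ : (fun _ => _) = fine \o (fubini_F (seed_law Q) (r^\+)%E \-
    fubini_F (seed_law Q) (r^\-)%E)%E); last first.
  apply/funext => w /=; have [_] := Q_unbiased (v w) j.
  rewrite unlock /fubini_F => Fv; rewrite -[LHS]/(fine (F (v w) 0 j)%:E) -Fv.
  rewrite -[(fun z => (realize Q z (v w) 0 j)%:E)]/(r \o (fun z => (w, z))).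
  by congr fine; rewrite [LHS]integralE funepos_comp funeneg_comp.
apply: measurableT_comp; first exact: fine_measurable.
apply: emeasurable_funB; apply: measurable_fun_fubini_tonelli_F => //.
  exact: measurable_funepos.
exact: measurable_funeneg.
Qed.

Let Fv_adapted : adapted G (F \o v) := adapted_mean.

Let noise (p : OG * seed Q) := realize Q p.2 (v p.1) - F (v p.1).

Let measurable_noise j : measurable_fun setT (fun p => noise p 0 j).
Proof.
rewrite (_ : (fun _ => _) = (fun p : OG * seed Q => realize Q p.2 (v p.1) 0 j)
    \- (fun p => F (v p.1) 0 j)); last first.
  by apply/funext => p; rewrite /noise !mxE.
apply: measurable_funB.
  apply: measurable_realize_comp => // i.
  by apply: (measurableT_comp (f := fun w : OG => v w 0 i)).
by apply: (measurableT_comp (f := fun w : OG => F (v w) 0 j)).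
Qed.

(** Freezing the past reduces the second moment to the seed variance at the point [v w], which is
    bounded pointwise before integrating over [w]. The form [C * sqnorm x + s] covers compression
    ([s = 0]) and gradient sampling ([C = 0]) at once. *)
Lemma fresh_noise_bound C s : square_integrable P v -> 0 <= C -> 0 <= s ->
  (forall x, 'E_(seed_law Q)[fun z => sqnorm (realize Q z x - F x)%R]
               <= (C * sqnorm x + s)%:E)%E ->
  square_integrable P (Y - (F \o v)) /\
  ip P (Y - (F \o v)) (Y - (F \o v)) <= C * ip P v v + s.
Proof.
move=> sv C0 s0 Qvar; have mN := measurable_noise.
have mYF j : measurable_fun setT (fun w => (Y - (F \o v)) w 0 j).
  rewrite (_ : (fun _ => _) = (fun p => noise p 0 j) \o
     ((fun w => (w, Z w)) : Omega -> OG * seed Q)) //.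
  apply: measurableT_comp; first exact: measurable_noise.
  apply: measurable_fun_pair => // _ A mA; rewrite setTI.
  exact: sub_sigma_measurable mA.
(* The bound is obtained first in extended reals, because it is also what proves the noise square
   integrable. *)
have Ebound : ('E_P[fun w => sqnorm ((Y - (F \o v)) w)] <=
    (C * ip P v v + s)%:E)%E.
  rewrite unlock.
  have := @ge0_freezing _ _ G G_meas R P _ _ _ Z
    (fun p => (sqnorm (noise p))%:E) Z_fresh.
  move=> /= ->; last 2 first.
  - apply/measurable_EFinP; apply: measurable_sum => j.
    exact: (measurable_funM (mN j) (mN j)).
  - by move=> p; rewrite lee_fin sqnorm_ge0.
  have icv : P.-integrable setT (fun w => (C * sqnorm (v w) + s)%:E).
    under eq_fun do rewrite EFinD EFinM.
    apply: integrableD => //.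
      by apply: integrableZl => //; exact: integrable_dotv.
    exact: finite_measure_integrable_cst.
  apply: (@le_trans _ _ (\int[P]_w (C * sqnorm (v w) + s)%:E)%E).
    apply: ge0_le_integral => //.
    - by move=> w _; apply: integral_ge0 => z _; rewrite lee_fin sqnorm_ge0.
    - apply: (@measurable_fun_sub_sigma _ _ G G_meas _ (\bar R)).
      apply: (@measurable_fun_fubini_tonelli_F _ _ OG (seed Q) R (seed_law Q)
        (fun p => (sqnorm (noise p))%:E)).
        apply/measurable_EFinP; apply: measurable_sum => j.
        exact: (measurable_funM (mN j) (mN j)).
      by move=> p; rewrite lee_fin sqnorm_ge0.
    - by move/measurable_int: icv.
    - by move=> w _; have := Qvar (v w); rewrite unlock.
  under eq_integral do rewrite EFinD.
  rewrite integralD//; last 2 first.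
    under eq_fun do rewrite EFinM.
    by apply: integrableZl => //; exact: integrable_dotv.
    exact: finite_measure_integrable_cst.
  under eq_integral do rewrite EFinM.
  rewrite integralZl//; last exact: integrable_dotv.
  rewrite integral_cst// [X in (s%:E * X)%E](_ : _ = 1%E); last first.
    exact: probability_setT.
  by rewrite mule1 EFinD EFinM -ipE.
have sYF : square_integrable P (Y - (F \o v)).
  apply: square_integrableP => //.
  by apply: (le_lt_trans Ebound); rewrite ltry.
split=> //; rewrite -lee_fin; apply: le_trans Ebound.
by rewrite expectation_sqnorm.
Qed.

(** Once the past is frozen, each coordinate of [u] is a constant factor and the matching coordinate
    of the noise has mean zero by unbiasedness. *)
Lemma fresh_noise_orthogonal u : adapted G u -> square_integrable P u ->
  square_integrable P (Y - (F \o v)) -> ip P u (Y - (F \o v)) = 0.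
Proof.
move=> au su sYF; have mN := measurable_noise; apply: EFin_inj; rewrite -ipE//.
under eq_integral do rewrite -sumEFin.
rewrite integral_sum//; last by move=> j; exact: integrable_coord_mul.
rewrite big1// => j _.
have iz w : (seed_law Q).-integrable setT (fun z => (noise (w, z) 0 j)%:E).
  have [iR _] := Q_unbiased (v w) j.
  rewrite (_ : (fun _ => _) = (fun z => (realize Q z (v w) 0 j)%:E) \-
    (fun=> (F (v w) 0 j)%:E))%E.
    by apply: integrableB => //; exact: finite_measure_integrable_cst.
  by apply/funext => z; rewrite /noise !mxE.
apply: (@freezing_centered _ _ G G_meas R P _ _ (seed_law Q) Z
    (fun p => (u p.1 0 j * noise p 0 j)%:E)) => //.
- apply/measurable_EFinP; apply: measurable_funM; last exact: mN.
  by apply: (measurableT_comp (f := fun w : OG => u w 0 j)).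
- exact: (integrable_coord_mul j su sYF).
- move=> w; under eq_fun do rewrite EFinM /=.
  by apply: integrableZl => //; exact: iz.
move=> w; under eq_integral do rewrite EFinM /=.
rewrite integralZl//.

have [iR EF] := Q_unbiased (v w) j.
rewrite (_ : (\int[_]_z _) = 0)%E ?mule0//.
under eq_integral do rewrite /noise !mxE/= EFinB.
rewrite integralB//; last exact: finite_measure_integrable_cst.
move: EF; rewrite unlock => ->.
rewrite integral_cst// [X in (_ * X)%E](_ : _ = 1%E) ?mule1 ?subee//.
exact: probability_setT.
Qed.

End fresh_random_map.

(** * Independence of the past and a fresh seed *)

Section independence.
Context (R : realType) (dsp : measure_display) (Omega : measurableType dsp).
Context (P : probability Omega R) (I : eqType) (E : I -> set (set Omega)).
Hypothesis E_meas : forall i, E i `<=` measurable.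
Hypothesis E_setT : forall i, E i setT.
Hypothesis E_setI : forall i, setI_closed (E i).
Hypothesis E_indep : mutually_independent P E.

Definition events_of (D : set I) : set (set Omega) := \bigcup_(i in D) E i.

Lemma events_of_measurable D : events_of D `<=` measurable.
Proof. by move=> A [i _]; exact: E_meas. Qed.

Lemma sub_events_of D D' : D `<=` D' -> events_of D `<=` <<s events_of D' >>.
Proof.
by move=> DD' A [i Di EA]; apply: sub_sigma_algebra; exists i => //; exact: DD'.
Qed.

(** Uniqueness of measures on a pi-system: [A] ranges over finite intersections of events indexed by
    [D], which generate the sigma-algebra, and there [P (A & B)] and [P A * P B] agree by mutual
    independence. *)
Lemma independent_events_of D s A B : ~ D s ->
  <<s events_of D >> A -> E s B -> (P (A `&` B) = P A * P B)%E.
Proof.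
move=> Ds.
pose C := [set A | exists J (a : I -> set Omega), [/\ uniq J,
  forall i, i \in J -> D i, forall i, E i (a i) &
  A = \bigcap_(i in [set` J]) a i]].
have CI : setI_closed C.
  move=> _ _ [J [a [uJ JD Ea ->]]] [J' [a' [uJ' JD' Ea' ->]]].
  (* The two index lists may overlap; each family is padded by [setT] outside its own list so that
     both live on the merged one. *)
  pose b (S : seq I) (a : I -> set Omega) i := if i \in S then a i else setT.
  exists (undup (J ++ J')), (fun i => b J a i `&` b J' a' i); split.
  - exact: undup_uniq.
  - by move=> i; rewrite mem_undup mem_cat => /orP[/JD|/JD'].
  - by move=> i; apply: E_setI; rewrite /b; case: ifP.
  apply/seteqP; split => [w [wJ wJ'] i /= _|w wJ].
    by rewrite /b; split; case: ifP => // iJ; [apply: wJ|apply: wJ'].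
  split=> i /= iJ.
    have := wJ i; rewrite /= mem_undup mem_cat iJ => /(_ isT)[].
    by rewrite /b iJ.
  have := wJ i; rewrite /= mem_undup mem_cat iJ orbT => /(_ isT)[_].
  by rewrite /b iJ.
have Cm : C `<=` measurable.
  move=> _ [J [a [_ _ Ea ->]]]; apply: fin_bigcap_measurable => // i _.
  exact: E_meas (Ea i).
have EC : <<s events_of D >> `<=` <<s C >>.
  apply: smallest_sub; first exact: smallest_sigma_algebra.
  move=> X [i Di EX]; apply: sub_sigma_algebra.
  exists [:: i], (fun j => if j == i then X else setT); split => //.
  - by move=> j; rewrite inE => /eqP ->.
  - by move=> j; case: eqP => // ->.
  apply/seteqP; split => [w Xw j /=|w /(_ i)].
    by rewrite inE => /eqP ->; rewrite eqxx.
  by rewrite /= eqxx mem_head; exact.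
move=> /EC CA EB; have mB := E_meas EB.
have PB0 : (0 <= fine (P B))%R by rewrite fine_ge0.
have PBE : ((NngNum PB0)%:num%:E = P B)%E by rewrite /= fineK ?fin_num_measure.
transitivity (mrestr P mB A); first by [].
transitivity (mscale (NngNum PB0) P A); last by rewrite /mscale PBE muleC.
apply: (@g_sigma_algebra_measure_unique _ R _ C Cm (fun=> setT)) => //.
- move=> _; exists [::], (fun=> setT); split => //.
  by apply/seteqP; split.
- by apply/seteqP; split=> // w _; exists 0%N.
- move=> _ [J [a [uJ JD Ea ->]]].
  rewrite /= /mrestr /mscale PBE.
  (* Since [s] is outside [J], independence applies to [s :: J] with the event [B] at [s], and then
     to [J] alone. *)
  have sJ : s \notin J by apply/negP => /JD.
  pose b i := if i == s then B else a i.
  have bJ i : i \in J -> b i = a i.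
    by rewrite /b; case: eqP => // -> sJ'; rewrite sJ' in sJ.
  have bE i : E i (b i) by rewrite /b; case: eqP => [->|].
  have -> : (\bigcap_(i in [set` J]) a i) `&` B =
            \bigcap_(i in [set` s :: J]) b i.
    apply/seteqP; split => [w [wJ wB] i|w wJ].
      rewrite /= inE => /orP[/eqP ->|iJ]; first by rewrite /b eqxx.
      by rewrite bJ//; exact: wJ.
    split=> [i /= iJ|].
      by rewrite -bJ//; apply: wJ; rewrite /= inE iJ orbT.
    have /(wJ s) : [set` s :: J] s by rewrite /= mem_head.
    by rewrite /b eqxx.
  rewrite E_indep//= ?sJ// big_cons {1}/b eqxx; congr (_ * _)%E.
  rewrite E_indep//; apply: eq_big_seq => i iJ; by rewrite bJ.
- by move=> _; rewrite /= /mrestr setTI ltey_eq fin_num_measure.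
Qed.

End independence.

(** * Measurability and integrability of the objective *)

(** The preimage of [B] is the union of the fibres of [t] over the countably many values that [g]
    sends into [B]. *)
Lemma measurable_countable_comp d (T : measurableType d) (C : countType)
    d' (S : measurableType d') (t : T -> C) (g : C -> S) :
  (forall c, measurable [set w | t w = c]) -> measurable_fun setT (g \o t).
Proof.
move=> mt _ B mB; rewrite setTI.
rewrite (_ : _ @^-1` B =
    \bigcup_c (if `[< B (g c) >] then [set w | t w = c] else set0)).
  apply: countable_bigcupT_measurable => [|c]; first exact: countableP.
  by case: ifP.
apply/seteqP; split => [w Bw|w [c _]] /=.
  by exists (t w) => //; rewrite asboolT.
by case: asboolP => // Bc /= ->.
Qed.

Section continuous_measurable.
Context (R : realType) (d : nat).

(** The mesh is [1 / m.+1], so no division by zero occurs. Cells are coded by finite functions into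
    [int], which form a countable type. *)
Definition grid_index (m : nat) (x : 'rV[R]_d) : {ffun 'I_d -> int} :=
  [ffun i => Num.floor (x 0 i * m.+1%:R)].

Definition grid_point (m : nat) (c : {ffun 'I_d -> int}) : 'rV[R]_d :=
  \row_i ((c i)%:~R / m.+1%:R).

Lemma grid_point_dist m (x : 'rV[R]_d) i :
  `|x 0 i - grid_point m (grid_index m x) 0 i| <= m.+1%:R^-1.
Proof.
rewrite !mxE ffunE; have m0 : 0 < m.+1%:R :> R by rewrite ltr0Sn.
have /andP[] := real_floor_itv (num_real (x 0 i * m.+1%:R)).
set z := (_ %:~R) => zx xz.
have -> : x 0 i - z / m.+1%:R = (x 0 i * m.+1%:R - z) / m.+1%:R.
  by rewrite mulrBl mulfK ?lt0r_neq0.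
have mV0 : 0 <= m.+1%:R^-1 :> R by rewrite invr_ge0 ltW.
rewrite normrM [`|_^-1|]ger0_norm// ler_piMl//.
rewrite ger0_norm ?subr_ge0// lerBlDl.
by move: xz; rewrite intrD => /ltW.
Qed.

(* [f \o v] is the limit of its values at the grid points below [v], and there are
   only countably many of these. *)
Lemma measurable_continuous_comp d' (T : measurableType d') (f : 'rV[R]_d -> R)
    (v : T -> 'rV[R]_d) :
  continuous f -> (forall i, measurable_fun setT (fun w => v w 0 i)) ->
  measurable_fun setT (f \o v).
Proof.
move=> cf mv.
apply: (@measurable_fun_cvg _ _ _ _
  (fun m => (f \o grid_point m) \o (grid_index m \o v))) => [m|w _].
  apply: measurable_countable_comp => c.
  rewrite (_ : [set _ | _] = \bigcap_(i in [set: 'I_d])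
     [set w | Num.floor (v w 0 i * m.+1%:R) = c i]); last first.
    apply/seteqP; split => [w /= <- i _ /=|w vw]; first by rewrite ffunE.
    by apply/ffunP => i; rewrite ffunE; exact: vw.
  apply: fin_bigcap_measurable => // i _.
  rewrite (_ : [set _ | _] = (fun w => v w 0 i * m.+1%:R) @^-1`
      `[(c i)%:~R, (c i + 1)%:~R[%classic); last first.
    apply/seteqP; split => w /=; rewrite in_itv /=; last exact: floor_def.
    by move=> <-; exact: floor_itv.
  rewrite -[X in measurable X]setTI.
  have : measurable_fun setT (fun w => v w 0 i * m.+1%:R).
    exact: measurable_funM.
  by apply.
apply: (cvg_comp (fun m => grid_point m (grid_index m (v w))) f _ (cf (v w))).
apply/(@cvg_ballP _ 'rV[R]_d) => e e0; near=> m; split => // i j.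
rewrite ord1 /ball /= (le_lt_trans (grid_point_dist _ _ _))//.
rewrite invf_plt ?posrE// (@lt_trans _ _ m%:R) ?ltr_nat//; near: m.
exact: nbhs_infty_gtr.
Unshelve. all: by end_near.
Qed.

End continuous_measurable.

Section descent.
Context (R : realType) (d : nat) (f : 'rV[R]_d -> R) (F : 'rV[R]_d -> 'rV[R]_d).
Context (L m : R).
Hypothesis L_gt0 : 0 < L.
Hypothesis f_descent : forall x y,
  f x <= f y + dotv (F y) (x - y) + L / 2 * sqnorm (x - y).
Hypothesis f_ge : forall x, m <= f x.

(* Compare [f] at [x] and at the gradient step [x - F x / L].  The one-sided descent
   inequality does not make [F] Lipschitz, so this is what controls [F]. *)
Lemma sqnorm_gradient_le x : sqnorm (F x) <= 2 * L * (f x - m).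
Proof.
have := f_descent (x - L^-1 *: F x) x; have := f_ge (x - L^-1 *: F x).
rewrite [x - _ - x]addrC addKr /sqnorm -scaleNr dotvC !dotvZl.
rewrite [dotv (F x) (_ *: _)]dotvC dotvZl.
set y := f (x + _); set s := dotv _ _ => my.
have -> : L / 2 * (- L^-1 * (- L^-1 * s)) = L^-1 * s / 2.
  by field; rewrite gt_eqF.
rewrite mulNr => yx; set t := L^-1 * s in yx.
have -> : s = L * t by rewrite /t mulrA mulfV ?mul1r// gt_eqF.
have : 0 <= L * (f x - m - t / 2) by apply: mulr_ge0; [exact: ltW|lra].
lra.
Qed.

Context (dsp : measure_display) (Omega : measurableType dsp).
Context (P : probability Omega R) (v : Omega -> 'rV[R]_d).
Hypothesis fv_meas : measurable_fun setT (f \o v).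
Hypothesis v_sq : square_integrable P v.

(** The values of [f] lie between [m] and the quadratic upper bound given by the descent inequality
    based at [0], so they are dominated by an integrable function of [v]. *)
Lemma integrable_objective : P.-integrable setT (fun w => (f (v w))%:E).
Proof.
have c0 := square_integrable_cst P (F 0).
apply: (@le_integrable _ _ _ P setT measurableT _
  (fun w => (`|m| + `|f 0|)%:E + (`|dotv (F 0) (v w)|%:E +
     (L / 2)%:E * (sqnorm (v w))%:E))%E).
- exact/measurable_EFinP.
- move=> w _; rewrite -EFinM -!EFinD !abse_EFin lee_fin.
  have sq0 : 0 <= L / 2 * sqnorm (v w).
    by rewrite mulr_ge0 ?sqnorm_ge0// divr_ge0// ltW.
  rewrite [leRHS]ger0_norm ?addr_ge0//.
  have := f_descent (v w) 0; rewrite subr0 => fv.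
  have := f_ge (v w); move: sq0 fv; move: (L / 2 * _) (dotv _ _) (f _) (f 0) => q s a b.
  have := ler_norm b; have := ler_norm s; have := ler_norm (- m).
  rewrite normrN ler_norml; have := normr_ge0 s; have := normr_ge0 b.
  by move=> *; apply/andP; split; have := normr_ge0 m; lra.
- apply: integrableD => //; first exact: finite_measure_integrable_cst.
  apply: integrableD => //.
    by apply: integrable_norm; exact: integrable_dotv.
  by apply: integrableZl => //; exact: integrable_dotv.
Qed.

(** By [sqnorm_gradient_le], integrability of the objective dominates the squared gradient. *)
Lemma square_integrable_gradient :
  (forall j, measurable_fun setT (fun w => F (v w) 0 j)) ->
  square_integrable P (F \o v).
Proof.
move=> mF j; split; first exact: mF.
apply: (@le_integrable _ _ _ P setT measurableT _
  (fun w => (2 * L)%:E * ((f (v w))%:E - m%:E))%E).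
- by apply/measurable_EFinP; exact: measurable_funX (mF j).
- move=> w _; rewrite -EFinB -EFinM !abse_EFin lee_fin.
  rewrite ger0_norm ?sqr_ge0//; apply: le_trans (ler_norm _).
  apply: le_trans (sqnorm_gradient_le _).
  rewrite /sqnorm /dotv (bigD1 j)//= expr2 lerDl sumr_ge0// => i _.
  by rewrite -expr2 sqr_ge0.
- apply: integrableZl => //; apply: integrableB => //.
    exact: integrable_objective.
  exact: finite_measure_integrable_cst.
Qed.

End descent.

(** * The descent inequality integrated along a random step *)

Section descent_in_expectation.
Context (R : realType) (d : nat) (f : 'rV[R]_d -> R) (F : 'rV[R]_d -> 'rV[R]_d).
Context (L : R) (dsp : measure_display) (Omega : measurableType dsp).
Context (P : probability Omega R).
Hypothesis f_descent : forall x y,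
  f x <= f y + dotv (F y) (x - y) + L / 2 * sqnorm (x - y).

Lemma expected_descent (x s : Omega -> 'rV[R]_d) b :
  square_integrable P x -> square_integrable P s ->
  square_integrable P (F \o x) ->
  P.-integrable setT (fun w => (f (x w))%:E) ->
  P.-integrable setT (fun w => (f ((x + b *: s) w))%:E) ->
  Rintegral P setT (f \o (x + b *: s)) <=
    Rintegral P setT (f \o x) + b * ip P (F \o x) s + L / 2 * b ^+ 2 * ip P s s.
Proof.
move=> sx ss sF fx fxs.
have i1 := integrable_dotv sF ss; have i2 := integrable_dotv ss ss.
have iZ c (g : Omega -> R) : P.-integrable setT (EFin \o g) ->
    P.-integrable setT (EFin \o (fun w => c * g w)).
  by move=> ig; rewrite /comp; under eq_fun do rewrite EFinM;
     exact: integrableZl.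
have iD (g h : Omega -> R) : P.-integrable setT (EFin \o g) ->
    P.-integrable setT (EFin \o h) ->
    P.-integrable setT (EFin \o (fun w => g w + h w)).
  by move=> ig ih; rewrite /comp; under eq_fun do rewrite EFinD;
     exact: integrableD.
have j1 := iZ b _ i1; have j2 := iZ (L / 2 * b ^+ 2) _ i2.
rewrite -(RintegralZl b measurableT i1) -(RintegralZl _ measurableT i2).
have j3 := iD _ _ fx j1.
rewrite -(RintegralD measurableT fx j1) -(RintegralD measurableT j3 j2).
apply: le_Rintegral => //; first exact: iD.
move=> w _; have := f_descent ((x + b *: s) w) (x w).
rewrite (_ : (x + b *: s) w - x w = b *: s w); last by rewrite /= addrC addKr.
rewrite [dotv (F _) (b *: _)]dotvC dotvZl [dotv (s w) _]dotvC.
rewrite /sqnorm dotvZl [dotv (s w) (_ *: _)]dotvC dotvZl /=.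
by congr (_ <= _ + _); ring.
Qed.

End descent_in_expectation.

(** * One fresh seed within a mutually independent family *)

Definition seed_time n (s : ('I_n * nat + 'I_n * nat + nat)%type) : nat :=
  match s with
  | inl (inl (_, k)) => k
  | inl (inr (_, k)) => k
  | inr k => k
  end.

Section noise.
Context (R : realType) (dsp : measure_display) (Omega : measurableType dsp).
Context (P : probability Omega R) (I : eqType) (E : I -> set (set Omega)).
Hypothesis E_meas : forall i, E i `<=` measurable.
Hypothesis E_setT : forall i, E i setT.
Hypothesis E_setI : forall i, setI_closed (E i).
Hypothesis E_indep : mutually_independent P E.

Lemma adapted_events d D D' (v : Omega -> 'rV[R]_d) :
  D `<=` D' -> adapted (events_of E D) v -> adapted (events_of E D') v.
Proof. by move=> DD'; apply: adapted_sub; exact: sub_events_of. Qed.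

(** The noise is orthogonal to everything that avoids the seed [s], not merely to the past: seeds of
    the same iteration are allowed in [u]. This is what makes the noises of distinct workers
    orthogonal. [D] collects the seeds on which the input [v] depends. *)
Lemma fresh_noise d (Q : random_map R d) (Z : {RV P >-> seed Q}) (s : I) D F v
    (C b : R) (Y := fun w => realize Q (Z w) (v w)) :
  E s = preimage_set_system setT Z measurable ->
  (forall A, measurable A -> distribution P Z A = seed_law Q A) ->
  unbiased_for Q F ->
  (forall x, 'E_(seed_law Q)[fun z => sqnorm (realize Q z x - F x)%R]
               <= (C * sqnorm x + b)%:E)%E ->
  0 <= C -> 0 <= b -> ~ D s ->
  adapted (events_of E D) v -> square_integrable P v ->
  square_integrable P (F \o v) ->
  [/\ adapted (events_of E (D `|` [set s])) Y, square_integrable P Y,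
      ip P (Y - (F \o v)) (Y - (F \o v)) <= C * ip P v v + b &
      forall u, adapted (events_of E [set~ s]) u -> square_integrable P u ->
        ip P u (Y - (F \o v)) = 0].
Proof.
move=> Es Zlaw QF Qvar C0 b0 Ds av sv sFv.
have fresh : forall A B, <<s events_of E [set~ s] >> A -> measurable B ->
    (P (A `&` Z @^-1` B) = P A * seed_law Q B)%E.
  move=> A B sA mB; rewrite -Zlaw// /distribution /pushforward.
  apply: (independent_events_of E_meas E_setT E_setI E_indep (D := [set~ s])
    (s := s)) => //; first exact.
  by rewrite Es; exists B => //; rewrite setTI.
have DC : D `<=` [set~ s] by move=> t Dt /= ts; apply: Ds; rewrite -ts.
have av' := adapted_events DC av.
have EGm := @events_of_measurable _ _ _ E E_meas.
have [sYF YF_le] := fresh_noise_bound (EGm _) fresh av' QF sv C0 b0 Qvar.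
split=> //.
- apply: (adapted_realize (G := events_of E D)) => // [|B mB].
    by apply: sub_events_of; exact: subsetUl.
  apply: sub_sigma_algebra; exists s; first by right.
  by rewrite Es; exists B => //; rewrite setTI.
- rewrite (_ : Y = (Y - (F \o v)) + (F \o v)); last by rewrite subrK.
  exact: square_integrableD.
by move=> u au su; apply: (fresh_noise_orthogonal (EGm _) fresh av' QF).
Qed.

End noise.

(** * Step-size conditions and the one-step inequality *)

Section parameters.
Context (R : realType).
Implicit Types (n L Cq Cm c alpha beta gamma : R).

(** The interval for [alpha] says that [2 (Cq + 1) alpha - 1] has absolute value at most [s], where
    [s ^+ 2 = 1 - t]. Squaring, multiplying by [c] and dividing by [4 (Cq + 1)] gives the last
    claim, since [c * t = 4 Cq (Cq + 1) / n]. *)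
Lemma alpha_admissible n Cq c alpha : 0 < n -> 0 <= Cq ->
  4 * Cq * (Cq + 1) / n <= c ->
  (1 - Num.sqrt (1 - 4 * Cq * (Cq + 1) / (n * c))) / (2 * (Cq + 1)) <= alpha ->
  alpha <= (1 + Num.sqrt (1 - 4 * Cq * (Cq + 1) / (n * c))) / (2 * (Cq + 1)) ->
  [/\ 0 <= c, 0 <= alpha & c * (alpha ^+ 2 * (Cq + 1) - alpha) <= - (Cq / n)].
Proof.
move=> n0 Cq0 c_ge a_ge a_le.
have C10 : 0 < 2 * (Cq + 1) by lra.
have num0 : 0 <= 4 * Cq * (Cq + 1) by nra.
have c0 : 0 <= c by apply: le_trans c_ge; rewrite divr_ge0// ltW.
have t0 : 0 <= 4 * Cq * (Cq + 1) / (n * c).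
  by rewrite divr_ge0// mulr_ge0// ltW.
move: a_ge a_le; rewrite ler_pdivrMr// ler_pdivlMr//.
set t := _ / (n * c) in t0 *; set s := Num.sqrt _ => a_ge a_le.
have s0 : 0 <= s by exact: sqrtr_ge0.
have s1 : s <= 1.
  by rewrite -sqrtr1 /s ler_wsqrtr// lerBlDr lerDl.
have a0 : 0 <= alpha.
  by rewrite -(pmulr_lge0 _ C10); apply: le_trans a_ge; rewrite subr_ge0.
split=> //.
(* For [c = 0] the quotient [t] is [0] by convention and says nothing; [c_ge] then forces [Cq = 0],
   and both sides vanish. *)
have [c_eq0|c_neq0] := eqVneq c 0.
  rewrite c_eq0 mul0r oppr_ge0; move: c_ge; rewrite c_eq0 ler_pdivrMr// mul0r.
  by rewrite ler_pdivrMr// mul0r; nra.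
have cpos : 0 < c by rewrite lt_def c_neq0.
have t1 : t <= 1.
  rewrite /t ler_pdivrMr ?mulr_gt0// mul1r.
  by move: c_ge; rewrite ler_pdivrMr// [c * n]mulrC.
have s2 : s ^+ 2 = 1 - t by rewrite sqr_sqrtr// subr_ge0.
have u2 : (alpha * (2 * (Cq + 1)) - 1) ^+ 2 <= 1 - t.
  by rewrite -s2 -[leLHS]real_normK ?num_real// ler_sqr ?nnegrE// ler_norml;
     apply/andP; split; lra.
have ct : c * t = 4 * Cq * (Cq + 1) / n.
  by rewrite /t; field; rewrite !gt_eqF.
have Cq10 : 0 < 4 * (Cq + 1) by lra.
rewrite -(ler_pM2l Cq10).
have -> : 4 * (Cq + 1) * - (Cq / n) = - (c * t) by rewrite ct; ring.
have : c * (alpha * (2 * (Cq + 1)) - 1) ^+ 2 <= c * (1 - t) by rewrite ler_pM2l.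
by lra.
Qed.

(** The first bound in [gamma_max] is the positive root of [6 L beta B x^2 + x - 2 L beta B / Cm]
    with [B = Cm + 1]. Below it this quadratic is nonpositive, and its product with [Cm beta / 2] is
    the claim. For [Cm = 0] the left side vanishes. *)
Lemma gamma_admissible L Cm c alpha beta gamma : 0 < L -> 0 <= Cm ->
  0 < beta -> 0 < gamma -> gamma <= gamma_max L Cm c alpha beta ->
  Cm * (3 * ((Cm + 1) * L * beta ^+ 2) * gamma ^+ 2 + beta * gamma / 2) <=
    (Cm + 1) * L * beta ^+ 2.
Proof.
move=> L0 Cm0 b0 g0; rewrite /gamma_max.
have B0 : 0 < Cm + 1 by lra.
have M0 : 0 < (Cm + 1) * L * beta ^+ 2 by rewrite !mulr_gt0// exprn_gt0.
have [-> _|Cm_neq0] := eqVneq Cm 0.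
  by rewrite mul0r add0r mul1r mulr_ge0 ?sqr_ge0// ltW.
have Cmpos : 0 < Cm by rewrite lt_def Cm_neq0.
rewrite le_min => /andP[+ _].
have D0 : 0 < 12 * L * beta * (Cm + 1) by rewrite !mulr_gt0.
set B := Cm + 1 in B0 M0 D0 *.
rewrite ler_pdivlMr//; set s := Num.sqrt _ => gs.
have s2 : s ^+ 2 = 1 + 48 * L ^+ 2 * beta ^+ 2 * B ^+ 2 / Cm.
  rewrite sqr_sqrtr// addr_ge0// divr_ge0//.
  by rewrite !mulr_ge0 ?sqr_ge0// ltW.
have : (gamma * (12 * L * beta * B) + 1) ^+ 2 <= s ^+ 2.
  rewrite ler_sqr ?nnegrE ?sqrtr_ge0//; first lra.
  by rewrite addr_ge0// mulr_ge0 ?ltW.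
rewrite s2 => quad.
(* The factor [24 L beta B] completes the square of [12 L beta B gamma + 1]. *)
have key : 24 * L * beta * B *
   (6 * L * beta * B * gamma ^+ 2 + gamma - 2 * L * beta * B / Cm) <= 0.
  have -> : 24 * L * beta * B *
      (6 * L * beta * B * gamma ^+ 2 + gamma - 2 * L * beta * B / Cm) =
      (gamma * (12 * L * beta * B) + 1) ^+ 2 -
      (1 + 48 * L ^+ 2 * beta ^+ 2 * B ^+ 2 / Cm).
    by field.
  by rewrite subr_le0.
have E0 : 0 < 24 * L * beta * B by rewrite !mulr_gt0.
move: key; rewrite pmulr_rle0// => key.
have : Cm * beta / 2 *
    (6 * L * beta * B * gamma ^+ 2 + gamma - 2 * L * beta * B / Cm) <= 0.
  by rewrite pmulr_rle0// !mulr_gt0// invr_gt0.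
move=> H; rewrite -subr_le0; apply: le_trans H; rewrite le_eqVlt; apply/orP; left.
by apply/eqP; rewrite /B; field.
Qed.

(* One step of the recursion for the Lyapunov function: [a_xy] stands for the
   expected inner product of [x] and [y], and [H], [D], [rho] are the averages over
   the workers of the squared norms of [h_i], of [grad f - h_i] and of the noise. *)
Lemma lyapunov_decrease n L Cq Cm c alpha beta gamma eta sigma2
    a_NN a_ee a_Ne a_qq a_qq' H H' D rho fx fx' (M := (Cm + 1) * L * beta ^+ 2) :
  0 < n -> 0 < L -> 0 <= Cq -> 0 <= Cm -> 0 < beta -> 0 < gamma ->
  0 <= c -> 0 <= alpha -> c * (alpha ^+ 2 * (Cq + 1) - alpha) <= - (Cq / n) ->
  Cm * (3 * M * gamma ^+ 2 + beta * gamma / 2) <= M -> `|eta| <= gamma ->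
  0 <= sigma2 -> 0 <= a_ee -> 0 <= a_qq -> 0 <= H -> 0 <= D ->
  0 <= eta ^+ 2 * a_ee + 2 * (eta * gamma) * a_Ne + gamma ^+ 2 * a_NN ->
  0 <= eta ^+ 2 * a_ee - 2 * (eta * gamma) * a_Ne + gamma ^+ 2 * a_NN ->
  a_ee <= Cm * a_qq ->
  a_qq' = eta ^+ 2 * a_ee - 2 * (eta * gamma) * a_Ne + gamma ^+ 2 * a_NN
          + gamma ^+ 2 * (rho / n) ->
  H' = (1 - alpha) * H + alpha * a_NN - alpha * (1 - alpha) * D
       + alpha ^+ 2 * rho ->
  rho <= Cq * D + (Cq + 1) * sigma2 ->
  fx' <= fx + beta * (eta * a_Ne - gamma * a_NN) + M / 2 * a_qq' ->
  M * a_qq' + fx' + 3 * c * M * gamma ^+ 2 * H'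
    + gamma * (beta / 2 - 3 * (1 + c * alpha) * M * gamma) * a_NN <=
  M * a_qq + fx + 3 * c * M * gamma ^+ 2 * H
    + 3 * M * (1 + n * c * alpha) * gamma ^+ 2 * sigma2 / n.
Proof.
move=> n0 L0 Cq0 Cm0 b0 g0 c0 a0 Hca HM eta_le sig0 ee0 qq0 H0 D0 sum0 dif0.
move=> ee_le qqE HE rho_le fx_le.
have M0 : 0 < M by rewrite !mulr_gt0 ?exprn_gt0//; lra.
have g20 : 0 < gamma ^+ 2 by rewrite exprn_gt0.
have eta2 : eta ^+ 2 <= gamma ^+ 2.
  by rewrite -[eta ^+ 2]real_normK ?num_real// ler_sqr ?nnegrE// ltW.
have eta2ee : eta ^+ 2 * a_ee <= gamma ^+ 2 * a_ee by rewrite ler_wpM2r.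
(* Young's inequality, extracted from [dif0] after enlarging [eta ^+ 2] to [gamma ^+ 2]; multiplying
   by [gamma] makes the two sides match. *)
have crossb : beta * eta * a_Ne <= beta * gamma / 2 * (a_NN + a_ee).
  rewrite -(ler_pM2l g0).
  have : 0 <= beta / 2 * (gamma ^+ 2 * a_ee - 2 * (eta * gamma) * a_Ne
      + gamma ^+ 2 * a_NN).
    by apply: mulr_ge0; lra.
  by lra.
have bg := mulr_gt0 b0 g0; have Mg := mulr_gt0 M0 g20.
(* The error terms are [3 M gamma^2] from [Mq] and [beta gamma / 2] from [crossb]; the term
   [M * a_qq] of the previous Lyapunov value absorbs them. *)
have eeM : (3 * M * gamma ^+ 2 + beta * gamma / 2) * a_ee <= M * a_qq.
  have k0 : 0 <= 3 * M * gamma ^+ 2 + beta * gamma / 2.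
    by lra.
  apply: (le_trans (ler_wpM2l k0 ee_le)).
  by rewrite mulrA [X in X * _]mulrC ler_wpM2r.
(* The coefficient of [rho], divided by [3 M gamma^2], is [k]. After [rho] is bounded, the condition
   on [alpha] is used twice: multiplied by [D] it makes the [D] terms nonpositive, and multiplied by
   [sigma2] it bounds the remaining variance. *)
have noise : rho / n / 2 + c * alpha ^+ 2 * rho - c * alpha * (1 - alpha) * D
    <= (1 + n * c * alpha) * sigma2 / n.
  pose k := (2 * n)^-1 + c * alpha ^+ 2.
  have k0 : 0 <= k by rewrite addr_ge0 ?mulr_ge0 ?sqr_ge0// invr_ge0 mulr_ge0// ltW.
  have := ler_wpM2l k0 rho_le.
  have nV : 0 < n^-1 by rewrite invr_gt0.
  have kE : k = n^-1 / 2 + c * alpha ^+ 2 by rewrite /k invfM mulrC.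
  have nn : (1 + n * c * alpha) * sigma2 / n = n^-1 * sigma2 + c * alpha * sigma2.
    by field; rewrite gt_eqF.
  rewrite nn kE; set z := n^-1 in nV Hca *.
  have := ler_wpM2r D0 Hca; have := ler_wpM2r sig0 Hca.
  have : 0 <= z * Cq * D by rewrite !mulr_ge0// ltW.
  have : 0 <= z * Cq * sigma2 by rewrite !mulr_ge0// ltW.
  have : 0 <= z * sigma2 by rewrite !mulr_ge0// ltW.
  by lra.
have MN : 0 <= 3 * M * gamma ^+ 2 by lra.
have := ler_wpM2l MN noise.
have cH : 0 <= 3 * c * M * gamma ^+ 2 * (alpha * H).
  have := mulr_ge0 (mulr_ge0 c0 (ltW Mg)) (mulr_ge0 a0 H0); lra.
(* The factor [3 / 2] adds the Lyapunov coefficient [1] and the descent coefficient [1 / 2]; the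
   inner factors [2] come from [sum0], which trades the cross term for the two squares. *)
have Mq : M * a_qq' * (3 / 2) <= M * (3 / 2) *
    (2 * gamma ^+ 2 * a_ee + 2 * gamma ^+ 2 * a_NN + gamma ^+ 2 * (rho / n)).
  rewrite -mulrA [a_qq' * _]mulrC mulrA; apply: ler_wpM2l; last lra.
  by rewrite mulr_ge0 ?divr_ge0// ltW.
rewrite HE; lra.
Qed.

End parameters.

(** * Analysis of a DORE run *)

Section dore_analysis.
Context (R : realType) (d n : nat) (n_gt0 : (0 < n)%N).
Context (f : 'rV[R]_d -> R) (F : 'rV[R]_d -> 'rV[R]_d) (L m : R) (L_gt0 : 0 < L).
Hypothesis f_cont : continuous f.
Hypothesis f_descent : forall x y,
  f x <= f y + dotv (F y) (x - y) + L / 2 * sqnorm (x - y).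
Hypothesis f_ge : forall x, m <= f x.
Context (Cq Cm : R) (Cq_ge0 : 0 <= Cq) (Cm_ge0 : 0 <= Cm).
Context (Qw Qm : random_map R d).
Hypothesis Qw_compression : compression_operator Cq Qw.
Hypothesis Qm_compression : compression_operator Cm Qm.
Context (sigma : 'I_n -> R) (G : 'I_n -> random_map R d).
Hypothesis G_unbiased : forall i, unbiased_for (G i) F.
Hypothesis G_variance : forall i x,
  ('E_(seed_law (G i))[fun z => sqnorm (realize (G i) z x - F x)%R]
     <= (sigma i ^+ 2)%:E)%E.
Context (dsp : measure_display) (Omega : measurableType dsp).
Context (P : probability Omega R).
Context (xi : forall i, nat -> {RV P >-> seed (G i)}).
Context (zeta : 'I_n -> nat -> {RV P >-> seed Qw}).
Context (omega : nat -> {RV P >-> seed Qm}).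
Hypothesis fresh : fresh_seeds xi zeta omega.
Context (alpha beta gamma eta : R) (x0 e0 : 'rV[R]_d).

Let E := seed_events xi zeta omega.
Let g w k i := realize (G i) (xi i k w).
Let Q w k i := realize Qw (zeta i k w).
Let S k w := dore_run alpha beta gamma eta x0 e0 (g w) (Q w)
               (fun k => realize Qm (omega k w)) k.
Let X := dore alpha beta gamma eta x0 e0 xi zeta omega.
Let herr k w := error (S k w).
Let hmas k w := master_h (S k w).

Let preimage_measurable d' (T : measurableType d') (Z : {RV P >-> T}) :
  [/\ preimage_set_system setT Z measurable `<=` measurable,
      preimage_set_system setT Z measurable setT &
      setI_closed (preimage_set_system setT Z measurable)].
Proof.
split.
- by move=> _ [B mB <-]; exact: measurable_funP.
- by exists setT => //; rewrite setTI preimage_setT.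
- move=> _ _ [A mA <-] [B mB <-]; exists (A `&` B); first exact: measurableI.
  by rewrite !setTI.
Qed.

Let E_props s : [/\ E s `<=` measurable, E s setT & setI_closed (E s)].
Proof.
by case: s => [[[i k]|[i k]]|k]; [exact: (preimage_measurable (xi i k))|
  exact: (preimage_measurable (zeta i k))|exact: (preimage_measurable (omega k))].
Qed.

Let E_meas s : E s `<=` measurable. Proof. by have [] := E_props s. Qed.
Let E_setT s : E s setT. Proof. by have [] := E_props s. Qed.
Let E_setI s : setI_closed (E s). Proof. by have [] := E_props s. Qed.

Let E_indep : mutually_independent P E. Proof. by case: fresh. Qed.

Let ev := events_of E.
Let past k := [set s : ('I_n * nat + 'I_n * nat + nat)%type | (seed_time s < k)%N].

Let adapted_ev D D' (v : Omega -> 'rV[R]_d) :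
  D `<=` D' -> adapted (ev D) v -> adapted (ev D') v.
Proof. exact: adapted_events. Qed.

Let adapted_meas D (v : Omega -> 'rV[R]_d) j :
  adapted (ev D) v -> measurable_fun setT (fun w => v w 0 j).
Proof.
move=> av.
by apply: (measurable_fun_sub_sigma (@events_of_measurable _ _ _ _ E_meas D)).
Qed.

Let gradient_comp D (v : Omega -> 'rV[R]_d) : adapted (ev D) v ->
  square_integrable P v ->
  [/\ P.-integrable setT (fun w => (f (v w))%:E), adapted (ev D) (F \o v) &
      square_integrable P (F \o v)].
Proof.
move=> av sv.
have aFv : adapted (ev D) (F \o v).
  (* [F] is measurable as the mean of the estimator of a worker; [n_gt0] provides worker [0]. *)
  exact: (adapted_mean av (G_unbiased (Ordinal n_gt0))).
have mfv : measurable_fun setT (f \o v).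
  by apply: measurable_continuous_comp => // i; exact: adapted_meas av.
split=> //; first exact: (integrable_objective L_gt0 f_descent f_ge mfv sv).
apply: (square_integrable_gradient L_gt0 f_descent f_ge mfv sv) => j.
exact: adapted_meas aFv.
Qed.

(** The state entering iteration [k] is a function of the seeds of earlier iterations. The third
    clause holds because the master adds the mean of the updates that the workers add; it makes the
    query an unbiased step. *)
Definition dore_invariant k :=
  [/\ adapted (ev (past k)) (xhat X k) /\ square_integrable P (xhat X k),
      forall i, adapted (ev (past k)) (hloc X i k) /\
                square_integrable P (hloc X i k),
      hmas k = n%:R^-1 *: \sum_i hloc X i k &
      adapted (ev (past k)) (herr k) /\ square_integrable P (herr k)].

Lemma dore_invariant0 : dore_invariant 0.
Proof.
split; [split|move=> i; split| |split];
  try exact: adapted_cst; try exact: square_integrable_cst.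
apply/funext => w; rewrite [RHS]/GRing.scale /= fct_sumE.
by rewrite big1 ?scaler0.
Qed.

Let sqn (v : Omega -> 'rV[R]_d) := ip P v v.
Let grd k := F \o xhat X k.
(** Given the past, [grd k - hloc X i k] is the mean of the compressed difference, so this is the
    combined sampling and compression noise of worker [i]. *)
Let noise i k : Omega -> 'rV[R]_d :=
  (fun w => dore_dhat (g w k) (Q w k) (S k w) i) - (grd k - hloc X i k).

(** Every vector is written as a part determined by the past plus centered noises, and squares are
    expanded with vanishing cross terms. The invariant is propagated along the way because the
    moment bounds also supply the integrability of the next state. *)
Lemma dore_step_bounds k : dore_invariant k ->
  [/\ dore_invariant k.+1, square_integrable P (qvec X k),
      sqn (herr k.+1) <= Cm * sqn (qvec X k),
      [/\ sqn (qvec X k) = eta ^+ 2 * sqn (herr k) -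
            2 * (eta * gamma) * ip P (grd k) (herr k) + gamma ^+ 2 * sqn (grd k)
            + gamma ^+ 2 * (n%:R^-1 * (\sum_i sqn (noise i k)) / n%:R),
          forall i, sqn (hloc X i k.+1) = (1 - alpha) * sqn (hloc X i k)
            + alpha * sqn (grd k)
            - alpha * (1 - alpha) * sqn (grd k - hloc X i k)
            + alpha ^+ 2 * sqn (noise i k) &
          forall i, sqn (noise i k) <= Cq * sqn (grd k - hloc X i k)
            + (Cq + 1) * sigma i ^+ 2] &
      Rintegral P setT (f \o xhat X k.+1) <= Rintegral P setT (f \o xhat X k)
        + beta * (eta * ip P (grd k) (herr k) - gamma * sqn (grd k))
        + (Cm + 1) * L * beta ^+ 2 / 2 * sqn (qvec X k)].
Proof.
move=> [[ax sx] ash hmasE [ae se]].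
have [xi_law zeta_law omega_law _] := fresh.
rewrite /sqn /grd; set x := xhat X k in ax sx *; pose h i := hloc X i k.
have ah i : adapted (ev (past k)) (h i) by have [] := ash i.
have sh i : square_integrable P (h i) by have [] := ash i.
set e := herr k in ae se *.
have [fx aN sN] := gradient_comp ax sx; set N := F \o x in aN sN *.
pose sxi i : ('I_n * nat + 'I_n * nat + nat)%type := inl (inl (i, k)).
pose szeta i : ('I_n * nat + 'I_n * nat + nat)%type := inl (inr (i, k)).
pose gi i w := realize (G i) (xi i k w) (x w).
have past_xi i : ~ past k (sxi i) by rewrite /past /= ltnn.
have gi_props i :
    [/\ adapted (ev (past k `|` [set sxi i])) (gi i), square_integrable P (gi i),
      ip P (gi i - N) (gi i - N) <= 0 * ip P x x + sigma i ^+ 2 &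
      forall u, adapted (ev [set~ sxi i]) u -> square_integrable P u ->
        ip P u (gi i - N) = 0].
  apply: (fresh_noise E_meas E_setT E_setI E_indep (s := sxi i) (F := F) (v := x)
    (erefl _) (xi_law i k)) => //.
  - by move=> y; rewrite mul0r add0r; exact: G_variance.
  - exact: sqr_ge0.
pose v i := gi i - h i; pose dh i w := realize Qw (zeta i k w) (v i w).
have agi i : adapted (ev (past k `|` [set sxi i])) (gi i) by case: (gi_props i).
have sgi i : square_integrable P (gi i) by case: (gi_props i).
have av i : adapted (ev (past k `|` [set sxi i])) (v i).
  by apply: adaptedB => //; apply: adapted_ev (ah i); exact: subsetUl.
have sv i : square_integrable P (v i) by exact: square_integrableB.
have dh_props i :
    [/\ adapted (ev (past k `|` [set sxi i] `|` [set szeta i])) (dh i),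
      square_integrable P (dh i),
      ip P (dh i - v i) (dh i - v i) <= Cq * ip P (v i) (v i) + 0 &
      forall u, adapted (ev [set~ szeta i]) u -> square_integrable P u ->
        ip P u (dh i - v i) = 0].
  have [Qunb Qvar] := Qw_compression.
  apply: (fresh_noise E_meas E_setT E_setI E_indep (s := szeta i) (F := id)
    (v := v i) (erefl _) (zeta_law i k)) => //.
  - by move=> y; rewrite addr0; exact: Qvar.
  - by case=> //; rewrite /past /= ltnn.
  - exact: sv.
have adh i : adapted (ev (past k `|` [set sxi i] `|` [set szeta i])) (dh i).
  by case: (dh_props i).
have sdh i : square_integrable P (dh i) by case: (dh_props i).
pose r i := noise i k.
have rE i : r i = (dh i - v i) + (gi i - N).
  by rewrite /v opprB -[RHS]addrA subrKA -opprB.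
have sNh i : square_integrable P (N - h i) by exact: square_integrableB.
have sr i : square_integrable P (r i).
  exact: (square_integrableB (sdh i) (sNh i)).
have ar i : adapted (ev (past k `|` [set sxi i] `|` [set szeta i])) (r i).
  apply: (adaptedB (adh i)).
  apply: (@adapted_ev (past k)); last exact: (adaptedB aN (ah i)).
  by move=> t; left; left.
(* The sampling part of [r i] is orthogonal to what avoids the seed [sxi i], the compression part to
   what avoids [szeta i]. *)
have r_orth i u : adapted (ev [set~ sxi i]) u -> adapted (ev [set~ szeta i]) u ->
    square_integrable P u -> ip P u (r i) = 0.
  move=> au1 au2 su; rewrite rE ipC ipDl//; try exact: square_integrableB.
  have [_ _ _ o1] := gi_props i; have [_ _ _ o2] := dh_props i.
  by rewrite ![ip P _ u]ipC o1// o2// addr0.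
have past_orth i u : adapted (ev (past k)) u -> square_integrable P u ->
    ip P u (r i) = 0.
  by move=> au; apply: r_orth; apply: adapted_ev au => t /= + ts;
     rewrite /past /= ts /= ltnn.
have cross i j : i != j -> ip P (r i) (r j) = 0.
  move=> ij; have nij : i <> j by apply/eqP.
  by apply: r_orth => //; apply: adapted_ev (ar i) => t [[|]|] /= + ts;
     rewrite ts /past /= ?ltnn// => -[] /esym.
(* Compression contributes [Cq] times the second moment of [v i], which itself contains the sampling
   variance; hence the factor [Cq + 1] on [sigma i ^+ 2]. *)
have noise_le i : ip P (r i) (r i) <= Cq * ip P (N - h i) (N - h i)
    + (Cq + 1) * sigma i ^+ 2.
  have [_ _ gvar go] := gi_props i; have [_ _ dvar do_] := dh_props i.
  have sgN : square_integrable P (gi i - N) by exact: square_integrableB.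
  have sdv : square_integrable P (dh i - v i) by exact: square_integrableB.
  have ggN : adapted (ev [set~ szeta i]) (gi i - N).
    apply: adaptedB.
      by apply: adapted_ev (agi i) => t [|] /= + ts; rewrite /past ts /= ?ltnn.
    by apply: adapted_ev aN => t /= + ts; rewrite /past /= ts /= ltnn.
  have vv : ip P (v i) (v i) = ip P (N - h i) (N - h i) + ip P (gi i - N) (gi i - N).
    have -> : v i = (N - h i) + 1 *: (gi i - N).
      by rewrite scale1r addrC addrA subrK.
    rewrite ip_sqrD// go ?mulr0 ?addr0 ?expr1n ?mul1r//.
    by apply: adaptedB; [apply: adapted_ev aN|apply: adapted_ev (ah i)];
       move=> t /= + ts; rewrite /past /= ts /= ltnn.
  have -> : ip P (r i) (r i) = ip P (dh i - v i) (dh i - v i)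
      + ip P (gi i - N) (gi i - N).
    have -> : r i = (dh i - v i) + 1 *: (gi i - N) by rewrite scale1r.
    rewrite ip_sqrD// [ip P (dh i - v i) (gi i - N)]ipC (do_ (gi i - N))//.
    by rewrite mulr0 addr0 expr1n mul1r.
  move: gvar dvar; rewrite vv mul0r add0r addr0.
  have := ler_wpM2l Cq_ge0 (_ : ip P (gi i - N) (gi i - N) <= sigma i ^+ 2).
  by move=> H gvar; have := H gvar; lra.
have sum_r_orth u : adapted (ev (past k)) u -> square_integrable P u ->
    ip P u (n%:R^-1 *: \sum_i r i) = 0.
  move=> au su; have sS := square_integrable_sum (index_enum _) sr.
  rewrite ipC ipZl// ip_suml// big1 ?mulr0// => i _.
  by rewrite ipC past_orth.
pose rbar := n%:R^-1 *: \sum_i r i.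
have srbar : square_integrable P rbar.
  by apply: square_integrableZ; exact: square_integrable_sum.
(* Only the diagonal terms survive, so averaging divides the noise by [n]. *)
have rbar_sq : ip P rbar rbar = n%:R^-1 * (\sum_i ip P (r i) (r i)) / n%:R.
  have sS := square_integrable_sum (index_enum _) sr.
  rewrite /rbar ipZl// ipC ipZl// ip_suml// -[RHS]mulrA [_ / n%:R]mulrC.
  congr (_ * (_ * _)); apply: eq_bigr => i _.
  rewrite ipC ip_suml// (bigD1 i)//= big1 ?addr0// => j ji.
  exact: cross.
pose q := qvec X k.
have qE : q = (eta *: e + (- gamma) *: N) + (- gamma) *: rbar.
  have hdh : hmas k + n%:R^-1 *: \sum_i dh i = N + rbar.
    have n0 : n%:R != 0 :> R by rewrite pnatr_eq0 -lt0n.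
    have NE : N = n%:R^-1 *: \sum_(i < n) N.
      apply/funext => w; rewrite [RHS]/GRing.scale /= fct_sumE sumr_const.
      by rewrite card_ord -[N w *+ n]scaler_nat scalerA mulVf// scale1r.
    rewrite hmasE [in RHS]NE -!scalerDr -!big_split; congr (_ *: _).
    apply: eq_bigr => i _ /=; rewrite /r /noise.
    by rewrite addrC -/(h i) -/N [RHS]addrC opprB addrA addrNK addrC.
  rewrite -addrA -scalerDr -hdh addrC.
  apply/funext => w; rewrite /q /= /dore_query /dore_mean_dhat.
  by rewrite [X in _ = X + _]/GRing.scale /= [in RHS]/GRing.add /= fct_sumE.
have sq_ : square_integrable P q.
  rewrite qE; apply: square_integrableD; last exact: square_integrableZ.
  by apply: square_integrableD; exact: square_integrableZ.
(* The seeds that the query depends on: everything up to iteration [k] except the master's own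
   compression seed, which stays fresh for [q]. *)
pose A := [set s : ('I_n * nat + 'I_n * nat + nat)%type |
  (seed_time s <= k)%N /\ s <> inr k].
have pastA : past k `<=` A.
  by move=> t; rewrite /past /= => tk; split; [exact: ltnW|];
     move=> tE; rewrite tE ltnn in tk.
have aq : adapted (ev A) q.
  rewrite qE; apply: adaptedD; last first.
    apply: adaptedZ; apply: adaptedZ; apply: adapted_sum => i.
    apply: adapted_ev (ar i) => t [[/pastA//|->]|->] /=; by split.
  by apply: adaptedD; apply: adaptedZ; [apply: adapted_ev ae|apply: adapted_ev aN].
pose qh w := realize Qm (omega k w) (q w).
have [aqh sqh qh_var qh_orth] :
    [/\ adapted (ev (A `|` [set inr k])) qh, square_integrable P qh,
      ip P (qh - q) (qh - q) <= Cm * ip P q q + 0 &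
      forall u, adapted (ev [set~ inr k]) u -> square_integrable P u ->
        ip P u (qh - q) = 0].
  have [Qunb Qvar] := Qm_compression.
  apply: (fresh_noise E_meas E_setT E_setI E_indep (s := inr k) (F := id)
    (v := q) (erefl _) (omega_law k)) => //.
  - by move=> y; rewrite addr0; exact: Qvar.
  - by case.
have Ainr : A `<=` [set~ inr k] by move=> t [].
have sqhq : square_integrable P (qh - q) by exact: square_integrableB.
have q_orth : ip P q (qh - q) = 0 by apply: qh_orth => //; exact: adapted_ev aq.
have N_orth : ip P N (qh - q) = 0.
  by apply: qh_orth => //; apply: adapted_ev aN => t /pastA/Ainr.
have xE : xhat X k.+1 = x + beta *: qh by [].
have eE : herr k.+1 = q - qh by [].
have hE i : hloc X i k.+1 = h i + alpha *: dh i by [].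
have Apast : A `|` [set inr k] `<=` past k.+1.
  by move=> t [[]|->] //=; rewrite /past /= ltnS.
have past_sub : past k `<=` past k.+1.
  by move=> t; rewrite /past /= => /ltnW; rewrite ltnS.
have Apast' : A `<=` past k.+1 by move=> t At; apply: Apast; left.
have ax' : adapted (ev (past k.+1)) (xhat X k.+1).
  rewrite xE; apply: adaptedD; first exact: adapted_ev ax.
  by apply: adaptedZ; exact: adapted_ev aqh.
have sx' : square_integrable P (xhat X k.+1).
  by rewrite xE; apply: square_integrableD => //; exact: square_integrableZ.
have invS : dore_invariant k.+1.
  split; first by [].
  - move=> i; rewrite hE; split.
      apply: adaptedD; first exact: adapted_ev (ah i).
      apply: adaptedZ; apply: adapted_ev (adh i).
      by move=> t [[/past_sub//|->]|->] /=; rewrite /past /= ltnS.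
    by apply: square_integrableD => //; exact: square_integrableZ.
  - transitivity (hmas k + alpha *: (n%:R^-1 *: \sum_i dh i)).
      apply/funext => w; rewrite /hmas /= /dore_mean_dhat.
      by rewrite [RHS]/GRing.add /= fct_sumE.
    rewrite hmasE scalerA mulrC -scalerA -scalerDr scaler_sumr -big_split.
    by congr (_ *: _); apply: eq_bigr => i _; rewrite hE.
  - rewrite eE; split; last exact: square_integrableB.
    by apply: adaptedB; [exact: adapted_ev aq|exact: adapted_ev aqh].
have [fx' _ _] := gradient_comp ax' sx'.
have sge a (v' : Omega -> 'rV[R]_d) : square_integrable P v' ->
  square_integrable P (a *: v') by exact: square_integrableZ.
have sX : square_integrable P (eta *: e + (- gamma) *: N).
  by apply: square_integrableD; exact: sge.
have qq : ip P q q = eta ^+ 2 * ip P e e - 2 * (eta * gamma) * ip P N e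
    + gamma ^+ 2 * ip P N N + gamma ^+ 2 * ip P rbar rbar.
  rewrite qE ip_sqrD// sum_r_orth//; last first.
    by apply: adaptedD; exact: adaptedZ.
  rewrite ip_sqrD//; last exact: sge.
  rewrite [ip P (eta *: e) N]ipZl// [ip P (eta *: e) (eta *: e)]ipZl//; last exact: sge.
  rewrite [ip P e (eta *: e)]ipC ipZl// [ip P e N]ipC; ring.
split=> //.
- rewrite eE (_ : q - qh = (-1) *: (qh - q)); last by rewrite scaleN1r opprB.
  rewrite ipZl//; last exact: sge.
  rewrite ipC ipZl// mulrA mulrNN !mul1r.
  by move: qh_var; rewrite addr0.
- split=> [|i|//].
    by rewrite -/q qq rbar_sq.
  (* The new [h] is a convex-type combination [(1 - alpha) h + alpha N] plus [alpha r]; the first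
     part expands by the identity for the squared norm of such a combination. *)
  rewrite hE (_ : dh i = (N - h i) + r i); last by rewrite addrC subrK.
  rewrite scalerDr addrA.
  have sD : square_integrable P (h i + alpha *: (N - h i)).
    by apply: square_integrableD => //; exact: sge.
  rewrite ip_sqrD// past_orth//; last first.
    by apply: adaptedD => //; apply: adaptedZ; exact: adaptedB.
  rewrite ip_sqrD//.
  have NN : ip P N N = ip P (h i) (h i) + 2 * ip P (h i) (N - h i)
      + ip P (N - h i) (N - h i).
    have {1 2}-> : N = h i + 1 *: (N - h i) by rewrite scale1r addrC subrK.
    by rewrite ip_sqrD// mulr1 expr1n mul1r.
  by rewrite NN -/(noise i k) -/(r i) -/(h i); ring.
rewrite -/q.
have := expected_descent f_descent (x := x) (s := qh) (b := beta) sx sqh sN fx.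
rewrite -xE => /(_ fx'); rewrite -/N => dsc; apply: (le_trans dsc).
have qhE : qh = q + 1 *: (qh - q) by rewrite scale1r addrC subrK.
(* The gradient does not involve the master's seed, so the compression error drops out of the inner
   product; the part of the query noise drops out next. *)
have -> : ip P N qh = ip P N q.
  rewrite {1}qhE ipC ipDl//; last exact: sge.
  by rewrite ipZl// [ip P (qh - q) N]ipC N_orth mulr0 addr0 ipC.
have -> : ip P N q = eta * ip P N e - gamma * ip P N N.
  rewrite qE ipC ipDl//; last exact: sge.
  rewrite [ip P (_ *: rbar) N]ipZl// [ip P rbar N]ipC sum_r_orth//.
  rewrite ipDl//; try exact: sge.
  by rewrite !ipZl// [ip P e N]ipC; ring.
have qh_le : ip P qh qh <= (Cm + 1) * ip P q q.
  rewrite qhE ip_sqrD// q_orth mulr0 addr0 expr1n mul1r.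
  by move: qh_var; lra.
have Lb : 0 <= L / 2 * beta ^+ 2.
  by rewrite mulr_ge0 ?sqr_ge0// divr_ge0// ltW.
have := ler_wpM2l Lb qh_le; rewrite /N; lra.
Qed.

Let mean_affine (p q r t z : R) (a a' b e : 'I_n -> R) :
  (forall i, a' i = p * a i + q * z - r * b i + t * e i) ->
  n%:R^-1 * (\sum_i a' i) = p * (n%:R^-1 * \sum_i a i) + q * z
    - r * (n%:R^-1 * \sum_i b i) + t * (n%:R^-1 * \sum_i e i).
Proof.
move=> aE; under eq_bigr do rewrite aE.
rewrite !big_split /= sumrN -!mulr_sumr sumr_const card_ord -[z *+ n]mulr_natl.
by field; rewrite pnatr_eq0 -lt0n.
Qed.

Lemma dore_invariantT k : dore_invariant k.
Proof.
by elim: k => [|k]; [exact: dore_invariant0|case/dore_step_bounds].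
Qed.

Context (c : R) (beta_gt0 : 0 < beta) (gamma_gt0 : 0 < gamma).
Hypotheses (c_ge0 : 0 <= c) (alpha_ge0 : 0 <= alpha).
Hypothesis alpha_adm : c * (alpha ^+ 2 * (Cq + 1) - alpha) <= - (Cq / n%:R).
Let M := (Cm + 1) * L * beta ^+ 2.
Hypothesis gamma_adm : Cm * (3 * M * gamma ^+ 2 + beta * gamma / 2) <= M.
Hypothesis eta_le : `|eta| <= gamma.

Let sigma2 := n%:R^-1 * \sum_i sigma i ^+ 2.
Let mean_h k := n%:R^-1 * \sum_i sqn (hloc X i k).

(** The constant optimal value is left out since it cancels in differences; [integral_Lyapunov]
    restores it. *)
Definition expected_lyapunov k :=
  M * sqn (qvec X k.-1) + Rintegral P setT (f \o xhat X k)
  + 3 * c * M * gamma ^+ 2 * mean_h k.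

Lemma expected_lyapunov_step k :
  expected_lyapunov k.+2
    + gamma * (beta / 2 - 3 * (1 + c * alpha) * M * gamma) * sqn (grd k.+1) <=
  expected_lyapunov k.+1
    + 3 * M * (1 + n%:R * c * alpha) * gamma ^+ 2 * sigma2 / n%:R.
Proof.
(* Two consecutive iterations enter: iteration [k] bounds the error entering [k.+1] by the previous
   query, and iteration [k.+1] gives the rest. The recursion starts at [1] because the initial error
   [e0] is arbitrary. *)
have [_ _ err_le _ _] := dore_step_bounds (dore_invariantT k).
have [_ _ _ [qqE hE noise_le] fx_le] := dore_step_bounds (dore_invariantT k.+1).
have [[ax sx] _ _ [_ se]] := dore_invariantT k.+1.
have [_ _ sN] := gradient_comp ax sx.
have n0 : 0 < n%:R :> R by rewrite ltr0n.
have nV0 : 0 <= n%:R^-1 :> R by rewrite invr_ge0 ltW.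
have avg_ge0 (a : 'I_n -> R) : (forall i, 0 <= a i) -> 0 <= n%:R^-1 * \sum_i a i.
  by move=> a0; rewrite mulr_ge0// sumr_ge0.
(* The values [gamma] and [- gamma] of [a] give the two sign conditions of [lyapunov_decrease]. *)
have sqr_e a : 0 <= eta ^+ 2 * sqn (herr k.+1) + 2 * (eta * a) *
    ip P (grd k.+1) (herr k.+1) + a ^+ 2 * sqn (grd k.+1).
  have se' := square_integrableZ eta se.
  have := ip_ge0 P (eta *: herr k.+1 + a *: grd k.+1).
  rewrite ip_sqrD// [ip P (eta *: _) (grd _)]ipZl// ipZl//.
  rewrite [ip P (herr _) (eta *: _)]ipC ipZl// [ip P (herr _) (grd _)]ipC.
  by congr (_ <= _); rewrite /sqn; ring.
apply: (@lyapunov_decrease R n%:R L Cq Cm c alpha beta gamma eta sigma2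
  (sqn (grd k.+1)) (sqn (herr k.+1)) (ip P (grd k.+1) (herr k.+1))
  (sqn (qvec X k)) (sqn (qvec X k.+1)) (mean_h k.+1) (mean_h k.+2)
  (n%:R^-1 * \sum_i sqn (grd k.+1 - hloc X i k.+1))
  (n%:R^-1 * \sum_i sqn (noise i k.+1))) => //.
- by apply: avg_ge0 => i; exact: sqr_ge0.
- exact: ip_ge0.
- exact: ip_ge0.
- by apply: avg_ge0 => i; exact: ip_ge0.
- by apply: avg_ge0 => i; exact: ip_ge0.
- by have := sqr_e (- gamma); congr (_ <= _); ring.
- exact: mean_affine hE.
- rewrite /sigma2 2![_ * (n%:R^-1 * _)]mulrCA -mulrDr ler_wpM2l// !mulr_sumr -big_split.
  exact: ler_sum.
Qed.

Lemma expected_lyapunov_telescope K :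
  expected_lyapunov K.+1 + gamma * (beta / 2 - 3 * (1 + c * alpha) * M * gamma)
    * \sum_(1 <= k < K.+1) sqn (grd k) <=
  expected_lyapunov 1 +
    K%:R * (3 * M * (1 + n%:R * c * alpha) * gamma ^+ 2 * sigma2 / n%:R).
Proof.
elim: K => [|K IHK]; first by rewrite big_geq// mulr0 mul0r !addr0.
rewrite big_nat_recr//= [X in _ + X <= _]mulrDr -[K.+1%:R]natr1.
rewrite [X in _ <= _ + X]mulrDl mul1r.
move: IHK (expected_lyapunov_step K).
move: (expected_lyapunov _) (expected_lyapunov _) (expected_lyapunov _).
move: (3 * M * _ * _ * _ / _) (gamma * (_ - _)) (\sum_(_ <= _ < _) _) (sqn _).
by move=> z y t t' l3 l2 l1; lra.
Qed.

Lemma integral_Lyapunov k (f' := optimal_value f) :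
  (\int[P]_w Lyapunov P f L Cm c beta gamma X k.+1 w)%E =
    (expected_lyapunov k.+1 - f')%:E.
Proof.
have [_ sq _ _ _] := dore_step_bounds (dore_invariantT k).
have [[ax sx] ash _ _] := dore_invariantT k.+1.
have [fx _ _] := gradient_comp ax sx.
(* The worker term of [Lyapunov] is already an expectation, so it joins the constant part. *)
pose C := 3 * c * M * gamma ^+ 2 * mean_h k.+1 - f'.
have LE w : Lyapunov P f L Cm c beta gamma X k.+1 w =
    ((M%:E * (sqnorm (qvec X k w))%:E + (f (xhat X k.+1 w))%:E) + C%:E)%E.
  rewrite /Lyapunov (eq_bigr (fun i => (sqn (hloc X i k.+1))%:E)); last first.
    by move=> i _; rewrite expectation_sqnorm//; have [] := ash i.
  rewrite sumEFin -!EFinM -!EFinD; congr EFin.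
  by rewrite /C /mean_h /M /f' /=; ring.
under eq_integral do rewrite LE.
have iq : P.-integrable setT (fun w => M%:E * (sqnorm (qvec X k w))%:E)%E.
  by apply: integrableZl => //; exact: integrable_dotv.
rewrite integralD//; last 2 first.
- exact: integrableD.
- exact: finite_measure_integrable_cst.
rewrite integralD// integralZl//; last exact: integrable_dotv.
rewrite integral_cst// [X in (C%:E * X)%E](_ : _ = 1%E) ?mule1; last first.
  exact: probability_setT.
rewrite [X in (M%:E * X)%E](ipE sq sq).
rewrite [X in (_ + X + _)%E](_ : _ = (Rintegral P setT (f \o xhat X k.+1))%:E).
  by rewrite -EFinM -!EFinD; congr EFin; rewrite /C /expected_lyapunov /sqn /=; ring.
by rewrite /Rintegral fineK//; exact: integrable_fin_num.
Qed.

Lemma expectation_sqnorm_gradient k :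
  'E_P[fun w => sqnorm (F (xhat X k w))]%E = (sqn (grd k))%:E.
Proof.
have [[ax sx] _ _ _] := dore_invariantT k.
have [_ _ sN] := gradient_comp ax sx.
by rewrite -expectation_sqnorm.
Qed.

(** All expectations are finite, so the claim is an inequality of reals: the telescoped one divided
    by [gamma * K%:R], the optimal value having cancelled. *)
Lemma dore_convergence K : (0 < K)%N ->
  (((beta / 2 - 3 * (1 + c * alpha) * (Cm + 1) * L * beta ^+ 2 * gamma)
      / K%:R)%:E
     * \sum_(1 <= k < K.+1) 'E_P[fun w => sqnorm (F (xhat X k w))]
   <= (\int[P]_w Lyapunov P f L Cm c beta gamma X 1%N w
        - \int[P]_w Lyapunov P f L Cm c beta gamma X K.+1 w)
        * ((gamma * K%:R)^-1)%:E
      + (3 * (Cm + 1) * (1 + n%:R * c * alpha) * L * beta ^+ 2 * sigma2 * gamma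
           / n%:R)%:E)%E.
Proof.
move=> K0; rewrite !integral_Lyapunov.
under eq_bigr do rewrite expectation_sqnorm_gradient.
rewrite sumEFin -EFinM -EFinB -EFinM -EFinD lee_fin.
have K1 : 0 < K%:R :> R by rewrite ltr0n.
have gK : 0 < gamma * K%:R by rewrite mulr_gt0.
have n1 : 0 < n%:R :> R by rewrite ltr0n.
rewrite -(ler_pM2r gK) [leRHS]mulrDl mulfVK ?gt_eqF//.
have := expected_lyapunov_telescope K; set T := \sum_(_ <= _ < _) _.
set l1 := expected_lyapunov 1; set lK := expected_lyapunov K.+1 => tele.
have -> : (beta / 2 - 3 * (1 + c * alpha) * (Cm + 1) * L * beta ^+ 2 * gamma)
    / K%:R * T * (gamma * K%:R) =
    gamma * (beta / 2 - 3 * (1 + c * alpha) * M * gamma) * T.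
  by rewrite /M; field; rewrite gt_eqF.
move: tele; set z := gamma * (_ - _) * T; move: z l1 lK => z l1 lK tele.
by rewrite /M in tele *; lra.
Qed.

End dore_analysis.

(** * Passage from the local objectives to their average *)

Unset Implicit Arguments.

Theorem theorem2 (R : realType) (d n : nat) (n_gt0 : (0 < n)%N)
  (fi : 'I_n -> 'rV[R]_d -> R) (L : R) (L_gt0 : 0 < L)
  (fi_smooth : forall i, lipschitz_differentiable L (fi i))
  (f_bounded_below : has_lbound (range (average fi)))
  (Cq Cm : R) (Cq_ge0 : 0 <= Cq) (Cm_ge0 : 0 <= Cm)
  (Qw Qm : random_map R d)
  (Qw_compression : compression_operator Cq Qw)
  (Qm_compression : compression_operator Cm Qm)
  (sigma : 'I_n -> R) (G : 'I_n -> random_map R d)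
  (G_sampling : forall i, gradient_sampler (sigma i) (fi i) (G i))
  (G_full_dataset : forall i, unbiased_for (G i) (grad (average fi)))
  (dsp : measure_display) (Omega : measurableType dsp) (P : probability Omega R)
  (xi : forall i, nat -> {RV P >-> seed (G i)})
  (zeta : 'I_n -> nat -> {RV P >-> seed Qw})
  (omega : nat -> {RV P >-> seed Qm})
  (fresh : fresh_seeds xi zeta omega)
  (alpha beta gamma eta c : R) (x0 e0 : 'rV[R]_d)
  (c_ge : 4 * Cq * (Cq + 1) / n%:R <= c)
  (alpha_ge : (1 - Num.sqrt (1 - 4 * Cq * (Cq + 1) / (n%:R * c)))
                / (2 * (Cq + 1)) <= alpha)
  (alpha_le : alpha <= (1 + Num.sqrt (1 - 4 * Cq * (Cq + 1) / (n%:R * c)))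
                / (2 * (Cq + 1)))
  (beta_gt0 : 0 < beta) (beta_le : beta <= 1 / (Cm + 1))
  (gamma_gt0 : 0 < gamma) (gamma_le : gamma <= gamma_max L Cm c alpha beta)
  (eta_le : `|eta| <= gamma)
  (K : nat) (K_gt0 : (0 < K)%N) :
  let f := average fi in
  let X := dore alpha beta gamma eta x0 e0 xi zeta omega in
  let Lambda := Lyapunov P f L Cm c beta gamma X in
  let sigma2 := n%:R^-1 * \sum_i sigma i ^+ 2 in
  (((beta / 2 - 3 * (1 + c * alpha) * (Cm + 1) * L * beta ^+ 2 * gamma)
      / K%:R)%:E
     * \sum_(1 <= k < K.+1) 'E_P[fun w => sqnorm (grad f (xhat X k w))]
   <= (\int[P]_w Lambda 1%N w - \int[P]_w Lambda K.+1 w)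
        * ((gamma * K%:R)^-1)%:E
      + (3 * (Cm + 1) * (1 + n%:R * c * alpha) * L * beta ^+ 2 * sigma2 * gamma
           / n%:R)%:E)%E.
Proof.
lazy zeta; set f := average fi.
have gradE i x : grad (fi i) x = grad f x.
  apply/rowP => j; have [Gi _] := G_sampling i.
  have [_ E1] := Gi x j; have [_ E2] := G_full_dataset i x j.
  by apply: EFin_inj; rewrite -E1 -E2.
have n0 : 0 < n%:R :> R by rewrite ltr0n.
have f_cont : continuous f.
  have -> : f = n%:R^-1 *: \sum_i fi i.
    by apply/funext => x; rewrite [RHS]/GRing.scale /= fct_sumE.
  move=> x; apply: differentiable_continuous; apply: differentiableZ.
  by apply: differentiable_sum => i; have [+ _] := fi_smooth i; exact.
have f_descent x y :
    f x <= f y + dotv (grad f y) (x - y) + L / 2 * sqnorm (x - y).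
  (* By [gradE] the increment [c0] is common to all workers; written as a mean of [n] copies, it
     lets the local inequalities be averaged term by term. *)
  rewrite -addrA; set c0 := dotv _ _ + L / 2 * _; rewrite -lerBlDl.
  have n1 : 0 <= n%:R^-1 :> R by rewrite invr_ge0 ltW.
  rewrite (_ : c0 = n%:R^-1 * \sum_(i < n) c0); last first.
    by rewrite sumr_const card_ord -[c0 *+ n]mulr_natl mulrA mulVf ?mul1r// gt_eqF.
  rewrite /f /average -mulrBr -sumrB ler_wpM2l//; apply: ler_sum => i _.
  have [_ /(_ x y)] := fi_smooth i.
  by rewrite gradE -addrA -/c0 -lerBlDl.
have f_ge x : optimal_value f <= f x.
  by apply: ge_inf => //; exists x.
have [c_ge0 alpha_ge0 alpha_adm] := alpha_admissible n0 Cq_ge0 c_ge alpha_ge alpha_le.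
have gamma_adm := gamma_admissible L_gt0 Cm_ge0 beta_gt0 gamma_gt0 gamma_le.
apply: (dore_convergence n_gt0 L_gt0 f_cont f_descent f_ge Cq_ge0 Cm_ge0
  Qw_compression Qm_compression G_full_dataset _ fresh) => //.
(* The variance bound around the local gradient becomes one around [grad f] by [gradE]. *)
move=> i x; have [_ Gvar] := G_sampling i; have := Gvar x.
by rewrite gradE.
Qed.
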